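(* Let $\lambda>0$, let $P$ be a nearest-neighbour translation-invariant jump distribution on $\mathbb{Z}$, and let $\zeta_c=\zeta_c(\lambda,P)$ be the critical density of the Activated Random Walk model on $\mathbb{Z}$ with sleep rate $\lambda$ and jump distribution $P$. Let $V_n=(-n/2,n/2]\cap\mathbb{Z}$. Then for every $\zeta>\zeta_c$, every $n\ge1$ and every initial configuration $\eta:V_n\to\mathbb{N}$ with $\|\eta\|=\sum_{x\in V_n}\eta(x)\ge\zeta n$ particles, initially all active, we have $$\mathbb{P}_\eta\big(M_n=0\big)\ \le\ \frac{\zeta_c}{\zeta},$$ where under $\mathbb{P}_\eta$ the variable $M_n$ is the number of particles that jump out of $V_n$ during the stabilization of $\eta$ in $V_n$, with particles being killed upon leaving $V_n$.
   Context: $\mathbb{N}=\{0,1,2,\dots\}$. A jump distribution on $\mathbb{Z}$ is a map $P:\mathbb{Z}\times\mathbb{Z}\to[0,1]$ with $\sum_y P(x,y)=1$ for all $x$; it is nearest-neighbour if $P(x,y)=0$ unless $|x-y|=1$, and translation-invariant if $P(x,y)$ depends only on $y-x$ (totally asymmetric walks are allowed). Configurations. A configuration is a function $\eta:\mathbb{Z}\to\mathbb{N}\cup\{\mathfrak{s}\}$: $\eta(x)=k\in\mathbb{N}$ means $k$ active particles at $x$, and $\eta(x)=\mathfrak{s}$ means exactly one sleeping particle at $x$. A site is stable if it is empty or contains a sleeping particle; a configuration is stable in $V$ if all sites of $V$ are stable. Instructions and topplings. Let $\mathcal{P}_{\lambda,P}$ be the law of an array $\tau=(\tau_{x,i})_{x\in\mathbb{Z},i\ge1}$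 of independent instructions, where $\tau_{x,i}$ is a sleep instruction with probability $\lambda/(1+\lambda)$ and a jump instruction to $y$ with probability $P(x,y)/(1+\lambda)$. Toppling $x$ means using the first unused instruction at $x$: a sleep instruction makes the particle at $x$ fall asleep if it is alone (nothing happens if there are at least two particles at $x$); a jump instruction to $y$ moves one particle from $x$ to $y$, and if there is a sleeping particle at $y$ it becomes active. Toppling $x$ is legal if $x$ contains at least one active particle. A finite sequence of sites is legal for $\eta$ if, starting from $\eta$ with no instruction used, each successive toppling is legal. Odometer and fixation. For a finite sequence of sites $\alpha$, $m_\alpha(x)$ is the number of occurrences of $x$ in $\alpha$, and $m^\tau_\eta(x)=\sup\{m_\alpha(x):\alpha \text{ legal for }\eta\}\in\mathbb{N}\cup\{\infty\}$. If $\eta$ has a translation-ergodic law $\nu$ and $\tau\sim\mathcal{P}_{\lambda,P}$ is independent of $\eta$, the event that the system fixates is $\{m^\tau_\eta(0)<\infty\}$; it has probability $0$ or $1$ (this agrees with the continuous-time definition: the origin is visited by active particles only finitely many times). The system stays active if it does not fixate. Critical density. It is a known theorem that there is a number $\zeta_c=\zeta_c(\lambda,P)$ such that, for every translation-ergodic law on $\mathbb{N}^{\mathbb{Z}}$ (no sleeping particles) of initial configurations with mean number of particles per site $\zeta$, the system almost surely fixates if $\zeta<\zeta_c$ and almost surely stays active if $\zeta>\zeta_c$. This defines $\zeta_c$. The variable $M_n$ under $\mathbb{P}_\eta$. Start from $\eta:V_n\to\mathbb{N}$ (extended by $0$ outside $V_n$), and perform legal topplings of sites of $V_n$ only, with $\tau\sim\mathcal{P}_{\lambda,P}$,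 until the configuration is stable in $V_n$ (this almost surely happens after finitely many topplings, and the result does not depend on the order of topplings). Particles which jump out of $V_n$ never move again, and $M_n$ is the number of particles located outside $V_n$ at the end. *)

(* Defs.v *)
From HB Require Import structures.
From mathcomp Require Import all_boot all_order all_algebra.
From mathcomp Require Import all_classical all_reals all_analysis.

Set Implicit Arguments.
Unset Strict Implicit.
Unset Printing Implicit Defensive.

Import Order.TTheory GRing.Theory Num.Theory.

Local Open Scope classical_set_scope.
Local Open Scope ring_scope.

Section JumpDistribution.
Context {R : realType}.
Implicit Types p : int -> int -> R.

Definition jump_distribution p : Prop :=
  (forall x y, 0 <= p x y <= 1) /\
  (forall x, (\esum_(y in [set: int]) (p x y)%:E = 1)%E).

Definition nearest_neighbour p : Prop :=
  forall x y, `|x - y| != 1 -> p x y = 0.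

Definition translation_invariant p : Prop :=
  forall x y x' y', y - x = y' - x' -> p x y = p x' y'.

End JumpDistribution.

Inductive site_state : Type := Active of nat | Sleeping.

Inductive instruction : Type := Sleep | Jump of int.

HB.instance Definition _ := gen_eqMixin instruction.
HB.instance Definition _ := gen_choiceMixin instruction.
HB.instance Definition _ := isPointed.Build instruction Sleep.

Definition configuration : Type := int -> site_state.

Definition particles (s : site_state) : nat :=
  match s with Active k => k | Sleeping => 1 end.

Definition all_active (eta : int -> nat) : configuration :=
  fun x => Active (eta x).

Definition has_active (xi : configuration) (x : int) : Prop :=
  exists2 k, xi x = Active k & (0 < k)%N.

Definition stable_site (s : site_state) : Prop := s = Active 0 \/ s = Sleeping.

Definition stable_in (V : set int) (xi : configuration) : Prop :=
  forall x, V x -> stable_site (xi x).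

Definition update (xi : configuration) (x : int) (s : site_state) :
    configuration :=
  fun y => if y == x then s else xi y.

Definition add_particle (xi : configuration) (y : int) : configuration :=
  update xi y (Active (particles (xi y)).+1).

(* Only meaningful when [x] holds an active particle. *)
Definition remove_particle (xi : configuration) (x : int) : configuration :=
  update xi x (Active (particles (xi x)).-1).

Definition execute (xi : configuration) (x : int) (a : instruction) :
    configuration :=
  match a with
  | Sleep => if xi x is Active 1 then update xi x Sleeping else xi
  | Jump y => add_particle (remove_particle xi x) y
  end.

(* Indices start at 0: [tau x i] is the (i+1)-th instruction at [x]. *)
Definition instruction_array : Type := int -> nat -> instruction.

(* A configuration with the number of instructions used so far at each site. *)
Definition state : Type := (configuration * (int -> nat))%type.

Definition initial_state (xi : configuration) : state := (xi, fun=> 0%N).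

Section Toppling.
Variable tau : instruction_array.

Definition topple (s : state) (x : int) : state :=
  (execute s.1 x (tau x (s.2 x)),
   fun y => if y == x then (s.2 y).+1 else s.2 y).

Fixpoint legal_from (s : state) (alpha : seq int) : Prop :=
  if alpha is x :: beta
  then has_active s.1 x /\ legal_from (topple s x) beta
  else True.

Definition legal (xi : configuration) (alpha : seq int) : Prop :=
  legal_from (initial_state xi) alpha.

Definition after (xi : configuration) (alpha : seq int) : configuration :=
  (foldl topple (initial_state xi) alpha).1.

Definition odometer (R : realType) (xi : configuration) (x : int) : \bar R :=
  ereal_sup [set ((count_mem x alpha)%:R)%:E | alpha in legal xi].

Definition fixates (R : realType) (xi : configuration) : Prop :=
  (odometer R xi 0 < +oo)%E.

Definition stabilizing (V : set int) (xi : configuration) : set (seq int) :=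
  [set alpha | [/\ forall x, x \in alpha -> V x,
                   legal xi alpha & stable_in V (after xi alpha)]].

(* By the abelian property the value does not depend on the stabilizing
   sequence picked by [xget].  On the null event where there is none, the
   default is the empty sequence: then [escaped = 0] below when [eta] vanishes
   outside [V], which can only enlarge that event. *)
Definition stabilized (V : set int) (xi : configuration) : configuration :=
  after xi (xget [::] (stabilizing V xi)).

(* The support of the sum is finite when [eta] has finite support. *)
Definition escaped (V : set int) (eta : int -> nat) : nat :=
  \big[addn/0%N]_(x \in ~` V) particles (stabilized V (all_active eta) x).

End Toppling.

(* Cylinders over single coordinates: the alphabets [nat] and [instruction] are
   countable, so they generate the product of the discrete sigma-algebras. *)
Definition config_cylinders : set (set (int -> nat)) :=
  [set C | exists x k, C = [set eta | eta x = k]].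

Definition configs := g_sigma_algebraType config_cylinders.

Definition array_cylinders : set (set instruction_array) :=
  [set C | exists x i a, C = [set tau | tau x i = a]].

Definition arrays := g_sigma_algebraType array_cylinders.

Section Laws.
Context {R : realType}.
Implicit Types (lambda : R) (p : int -> int -> R).

Definition instruction_prob lambda p (x : int) (a : instruction) : R :=
  match a with
  | Sleep => lambda / (1 + lambda)
  | Jump y => p x y / (1 + lambda)
  end.

Definition mutually_independent (Q : probability arrays R) : Prop :=
  forall (s : seq (int * nat)) (B : int * nat -> set instruction), uniq s ->
    (Q [set tau : arrays | forall z, z \in s -> B z (tau z.1 z.2)] =
     \prod_(z <- s) Q [set tau : arrays | B z (tau z.1 z.2)])%E.

Definition array_law lambda p (Q : probability arrays R) : Prop :=
  mutually_independent Q /\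
  forall x i a,
    (Q [set tau : arrays | tau x i = a] = (instruction_prob lambda p x a)%:E)%E.

Definition translate (z : int) (eta : configs) : configs :=
  fun x => eta (x + z).

Definition translation_ergodic (nu : probability configs R) : Prop :=
  (forall (z : int) (A : set configs), measurable A ->
     nu (translate z @^-1` A) = nu A) /\
  (forall A : set configs, measurable A ->
     (forall z : int, translate z @^-1` A = A) ->
     nu A = 0%E \/ nu A = 1%E).

Definition mean_density (nu : probability configs R) : \bar R :=
  (\int[nu]_eta ((eta 0)%:R)%:E)%E.

(* The initial configuration and the instructions are independent: their joint
   law is the product measure. *)
Definition critical_density lambda p (zeta_c : R) : Prop :=
  forall (Q : probability arrays R) (nu : probability configs R) (zeta : R),
    array_law lambda p Q ->
    translation_ergodic nu ->
    mean_density nu = zeta%:E ->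
    (zeta < zeta_c ->
       {ae (nu \x Q)%E, forall w, fixates w.2 R (all_active w.1)}) /\
    (zeta_c < zeta ->
       {ae (nu \x Q)%E, forall w, ~ fixates w.2 R (all_active w.1)}).

End Laws.

Definition box (n : nat) : set int :=
  [set x : int | - (n%:R / 2 : rat) < x%:~R <= (n%:R / 2 : rat)].

(* Main.v *)
(* Suppose that [q = P (M_n = 0)] exceeds [zeta_c / zeta], let [k] be the number
   of particles of [eta], and choose [r / M] between [zeta_c * n / k] and [q].
   Tile the line with translates of the box (slots) and put a copy of [eta] in
   [r] slots out of every [M].  A uniform shift of this periodic configuration
   is ergodic with density [r * k / (M * n) > zeta_c], so it stays active almost
   surely.  A contradiction arises by exhibiting, with positive probability, a
   finite function [u] bounding the odometer.

   By the least action principle it is enough that [u] satisfies at each site a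
   local inequality: at most one particle is left, and none unless the last
   instruction used there is a sleep.  Start from an edge crossed by nobody and
   explore each half-line outwards.  If the net flow [D >= 0] towards the edge
   is prescribed, the number of jumps back needed at a site is determined by
   the previous site, and [u] is the least number of instructions providing
   them.  This can bring a copy of [eta] into a slot, or nothing.  A slot is
   good if the instructions left there stabilize [eta] without exit; since these
   are fresh, the slots are good independently with probability [q].  Place a
   copy of [eta] in each good slot and nothing in the others: the flow stays
   nonnegative as long as, from the edge on, the good slots are at least as many
   as the initially occupied ones, and since [r / M < q] this holds forever with
   positive probability. *)

Require Import Defs.
From HB Require Import structures.
From mathcomp Require Import all_boot all_order all_algebra.
From mathcomp Require Import all_classical all_reals all_analysis.
From mathcomp Require Import measurable_realfun zify lra.

Set Implicit Arguments.
Unset Strict Implicit.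
Unset Printing Implicit Defensive.

Import Order.TTheory GRing.Theory Num.Theory numFieldNormedType.Exports.

Local Open Scope classical_set_scope.
Local Open Scope ring_scope.

(** * Least action principle *)

Definition cnt (tau : instruction_array) (x : int) (a : instruction) (m : nat) :=
  count (fun i => tau x i == a) (iota 0 m).

Definition jumps (tau : instruction_array) (x : int) (m : nat) :=
  count (fun i => tau x i != Sleep) (iota 0 m).

Definition ends_asleep (tau : instruction_array) (x : int) (m : nat) : bool :=
  (0 < m)%N && (tau x m.-1 == Sleep).

(** Sources range over a finite list because an odometer may have infinite support; the inequalities
    below are then required for every such list. *)
Definition incoming tau (F : seq int) (u : int -> nat) (x : int) : nat :=
  (\sum_(y <- F) cnt tau y (Jump x) (u y))%N.

Lemma cntS tau x a m : cnt tau x a m.+1 = (cnt tau x a m + (tau x m == a))%N.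
Proof. by rewrite /cnt -addn1 iotaD count_cat /= addn0. Qed.

Lemma jumpsS tau x m : jumps tau x m.+1 = (jumps tau x m + (tau x m != Sleep))%N.
Proof. by rewrite /jumps -addn1 iotaD count_cat /= addn0. Qed.

Lemma cnt_mono tau x a : {homo cnt tau x a : m n / (m <= n)%N}.
Proof.
by move=> m n mn; rewrite /cnt -(subnKC mn) iotaD count_cat leq_addr.
Qed.

Lemma incoming_mono tau F u v x : (forall y, y \in F -> (u y <= v y)%N) ->
  (incoming tau F u x <= incoming tau F v x)%N.
Proof.
move=> uv; rewrite /incoming big_seq [leqRHS]big_seq; apply: leq_sum => y yF.
by apply: cnt_mono; exact: uv.
Qed.

Section Legal.
Variables (tau : instruction_array) (c : int -> nat).

Lemma legal_from_rcons s alpha x :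
  legal_from tau s (rcons alpha x) <->
  legal_from tau s alpha /\ has_active (foldl (topple tau) s alpha).1 x.
Proof.
elim: alpha s => [|y alpha IH] s /=; first by tauto.
by rewrite IH; tauto.
Qed.

Lemma legal_rcons alpha x :
  legal tau (all_active c) (rcons alpha x) <->
  legal tau (all_active c) alpha /\ has_active (after tau (all_active c) alpha) x.
Proof. exact: legal_from_rcons. Qed.

Lemma used_count alpha x :
  (foldl (topple tau) (initial_state (all_active c)) alpha).2 x = count_mem x alpha.
Proof.
elim/last_ind: alpha => [//|alpha y IH].
rewrite foldl_rcons -cats1 count_cat /= addn0 IH eq_sym.
by case: eqP => _; rewrite ?addn1 ?addn0.
Qed.

Lemma after_rcons alpha x : after tau (all_active c) (rcons alpha x) =
  execute (after tau (all_active c) alpha) x (tau x (count_mem x alpha)).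
Proof. by rewrite /after foldl_rcons /= used_count. Qed.

Lemma incoming_rcons F alpha x z : uniq F -> x \in F ->
  incoming tau F (fun y => count_mem y (rcons alpha x)) z =
  (incoming tau F (fun y => count_mem y alpha) z
     + (tau x (count_mem x alpha) == Jump z))%N.
Proof.
move=> uF xF; rewrite /incoming !(bigD1_seq x xF uF) /=.
rewrite -cats1 count_cat /= eqxx addn0 addn1 cntS -!addnA; congr addn.
rewrite addnC; congr addn; apply: eq_bigr => y yx.
by rewrite count_cat /= addn0 (eq_sym x) (negbTE yx) addn0.
Qed.

Lemma jumps_rcons alpha x z :
  jumps tau z (count_mem z (rcons alpha x)) =
  (jumps tau z (count_mem z alpha)
     + ((x == z) && (tau x (count_mem x alpha) != Sleep)))%N.
Proof.
rewrite -cats1 count_cat /= addn0; case: eqP => [->|_] /=.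
  by rewrite addn1 jumpsS.
by rewrite !addn0.
Qed.

(** Mass balance, by induction on the topplings: a sleep leaves both sides unchanged, a jump
    exchanges a particle for a used jump at its source and adds one to both sides at its target. All
    toppled sites must lie in [F] for every arrival to be counted. *)
Lemma particles_conservation F alpha x : uniq F -> {subset alpha <= F} ->
  legal tau (all_active c) alpha ->
  (particles (after tau (all_active c) alpha x) + jumps tau x (count_mem x alpha)
   = c x + incoming tau F (fun y => count_mem y alpha) x)%N.
Proof.
move=> uF; elim/last_ind: alpha => [|alpha y IH] sub.
  by rewrite /incoming big1//= /after /= addn0.
move=> /legal_rcons[leg [k act k0]].
have yF : y \in F by apply: sub; rewrite mem_rcons mem_head.
have /IH /(_ leg) {}IH : {subset alpha <= F}.
  by move=> z za; apply: sub; rewrite mem_rcons inE za orbT.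
rewrite incoming_rcons// addnA -IH jumps_rcons after_rcons.
set xi := after _ _ _ in act *.
case: (tau y _) => [|z] /=.
  rewrite eqxx andbF addn0 (_ : (Sleep == Jump x) = false) ?addn0; last exact/eqP.
  rewrite act; case: k k0 act => [//|[|k]] _ act //=.
  by rewrite /update; case: eqP => // ->; rewrite act.
rewrite /add_particle /remove_particle /update.
have -> : (Jump z == Jump x) = (x == z).
  by apply/eqP/eqP => [[->]//|->].
rewrite (_ : (Jump z == Sleep) = false) ?andbT//; last exact/eqP.
rewrite (eq_sym y x).
case: (x =P z) => [<-|xz]; case: (x =P y) => [xy|xy] /=;
  rewrite -?xy ?act /= ?eqxx /=; subst; rewrite ?act /= ?(negbTE (introN eqP xy)); lia.
Qed.

(** A sleep instruction either puts a lone particle to sleep or acts on at least two; a later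
    arrival turns the first case into the second, and the disjunction lasts until the next toppling
    of [x]. *)
Lemma sleep_invariant alpha x : legal tau (all_active c) alpha ->
  let s := after tau (all_active c) alpha x in
  (ends_asleep tau x (count_mem x alpha) -> s = Sleeping \/ (2 <= particles s)%N) /\
  (s = Sleeping -> ends_asleep tau x (count_mem x alpha)).
Proof.
elim/last_ind: alpha => [|alpha y IH] //=.
move=> /legal_rcons[/IH[IH1 IH2] [k act k0]]; rewrite after_rcons.
set xi := after _ _ _ in act IH1 IH2 *.
rewrite -cats1 count_cat /= addn0.
have [yx|yx] := eqVneq y x; last first.
  rewrite addn0; case: (tau y _) => [|z] /=.
    rewrite act; case: k k0 act => [//|[|k]] _ act //=.
    by rewrite /update eq_sym (negbTE yx).
  rewrite /add_particle /remove_particle /update (eq_sym x y) (negbTE yx).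
  have [xz|xz] := eqVneq x z; last by [].
  rewrite -xz (eq_sym x y) (negbTE yx) /=; split=> //.
  by move=> /IH1[->//|]; [right|move=> ?; right; lia].
rewrite addn1 /ends_asleep /=.
subst y; case: (tau x _) => [|z] /=.
  split; rewrite ?eqxx// => _; rewrite act.
  case: k k0 act => [//|[|k]] _ act.
    by left; rewrite /update eqxx.
  by right; rewrite act.
split; first by move=> /eqP.
rewrite /add_particle /remove_particle /update; case: eqP => // _.
by rewrite eqxx.
Qed.

(* The inequality at [x] says that [u] leaves at most one particle at [x], and
   none unless the last instruction used there is a sleep; it need not come
   from an actual sequence of topplings. *)
Definition supersolution (u : int -> nat) (x : int) : Prop :=
  forall F, uniq F ->
    (c x + incoming tau F u x <= jumps tau x (u x) + ends_asleep tau x (u x))%N.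

(** Consider the first toppling at [x] that would exceed [u x]: the odometer is still at most [u]
    everywhere, so mass balance leaves at most [ends_asleep] particles at [x]. *)
Lemma least_action (V : set int) u : (forall x, V x -> supersolution u x) ->
  forall alpha, legal tau (all_active c) alpha -> (forall x, x \in alpha -> V x) ->
  forall x, (count_mem x alpha <= u x)%N.
Proof.
move=> su; elim/last_ind => [//|alpha y IH] /legal_rcons[leg act] sub x.
have {}IH : forall z, (count_mem z alpha <= u z)%N.
  by apply: IH => // t ta; apply: sub; rewrite mem_rcons inE ta orbT.
rewrite -cats1 count_cat /= addn0; case: (y =P x) => [yx|]; last by rewrite addn0.
rewrite addn1 ltnNge; apply/negP => ux; subst y.
have {ux} cu : count_mem x alpha = u x by apply/eqP; rewrite eqn_leq IH ux.
have uu := undup_uniq alpha.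
have Vx : V x by apply: sub; rewrite mem_rcons mem_head.
have := su x Vx _ uu.
have sub_undup : {subset alpha <= undup alpha} by move=> z; rewrite mem_undup.
have cons := particles_conservation x uu sub_undup leg.
have := @incoming_mono tau (undup alpha) _ u x (fun z _ => IH z).
have := sleep_invariant x leg => /= -[+ _]; rewrite cu.
case: act => k act k0; move: cons; rewrite act cu /=.
(* Without a final sleep the site is empty; with one it holds at most one particle, whereas
   [sleep_invariant] gives a sleeping particle or at least two. An active particle contradicts
   both. *)
case: ends_asleep => /=; last by lia.
by move=> + /(_ isT)[//|]; lia.
Qed.

(** A stable site is empty, or holds one sleeping particle, and then the last instruction used there
    is a sleep; mass balance becomes the inequality. *)
Lemma stable_supersolution (V : set int) alpha x :
  stabilizing tau V (all_active c) alpha -> V x ->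
  supersolution (fun y => count_mem y alpha) x.
Proof.
move=> [sub leg st] Vx F uF.
(* Mass balance needs a list containing [alpha]; enlarging [F] can only increase the arrivals. *)
set G := undup (alpha ++ F).
have uG : uniq G by rewrite undup_uniq.
have sG : {subset alpha <= G}.
  by move=> z za; rewrite mem_undup mem_cat za.
have cons := particles_conservation x uG sG leg.
have FG : (incoming tau F (fun y => count_mem y alpha) x <=
           incoming tau G (fun y => count_mem y alpha) x)%N.
  rewrite /incoming [leqRHS](perm_big (F ++ [seq y <- G | y \notin F])); last first.
    apply: uniq_perm => //.
      rewrite cat_uniq uF filter_uniq//= andbT.
      by apply/hasPn => z; rewrite mem_filter => /andP[].
    move=> z; rewrite mem_cat mem_filter !mem_undup mem_cat.
    by case: (z \in F); rewrite ?orbT//= orbF.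
  by rewrite big_cat leq_addr.
have := sleep_invariant x leg => /= -[_ sl].
have := st x Vx; case=> e; move: cons; rewrite e [particles _]/=.
  by rewrite add0n => ->; rewrite (leq_trans _ (leq_addr _ _))// leq_add2l.
by rewrite (sl e) addn1 add1n => ->; rewrite leq_add2l.
Qed.

(** Abelian property: each odometer is a supersolution on [V], so least action applies both ways. *)
Lemma stabilizing_count (V : set int) alpha beta :
  stabilizing tau V (all_active c) alpha ->
  stabilizing tau V (all_active c) beta ->
  forall x, count_mem x alpha = count_mem x beta.
Proof.
move=> sa sb x; apply/eqP; rewrite eqn_leq; apply/andP; split.
- case: sa => suba lega _.
  exact: (least_action (fun z => stable_supersolution sb (x := z)) lega suba x).
- case: sb => subb legb _.
  exact: (least_action (fun z => stable_supersolution sa (x := z)) legb subb x).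
Qed.

Lemma stabilizing_particles (V : set int) alpha beta x :
  stabilizing tau V (all_active c) alpha ->
  stabilizing tau V (all_active c) beta ->
  particles (after tau (all_active c) alpha x) =
  particles (after tau (all_active c) beta x).
Proof.
move=> sa sb; have cab := stabilizing_count sa sb.
set F := undup (alpha ++ beta).
have uF : uniq F by rewrite undup_uniq.
have [_ la _] := sa; have [_ lb _] := sb.
have aF : {subset alpha <= F} by move=> z za; rewrite mem_undup mem_cat za.
have bF : {subset beta <= F} by move=> z za; rewrite mem_undup mem_cat za orbT.
have := particles_conservation x uF aF la.
have := particles_conservation x uF bF lb.
rewrite cab (_ : (fun y => count_mem y alpha) = (fun y => count_mem y beta)).
  by move=> <- /addIn.
exact/funext.
Qed.

(** Least action bounds the length of legal sequences in the finite set [V], so a longest one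
    exists; an active site of [V] would allow it to be extended. *)
Lemma exists_stabilizing (V : set int) (W : seq int) u : [set` W] = V ->
  (forall x, V x -> supersolution u x) ->
  exists alpha, stabilizing tau V (all_active c) alpha.
Proof.
move=> WV su.
pose P k := `[< exists2 alpha, (legal tau (all_active c) alpha /\
  (forall x, x \in alpha -> V x)) & size alpha = k >].
have P0 : exists k, P k by exists 0%N; apply/asboolP; exists [::].
have Pbound k : P k -> (k <= \sum_(x <- undup W) u x)%N.
  move=> /asboolP[alpha [leg sub] <-].
  have le := least_action su leg sub.
  rewrite (@leq_trans (\sum_(x <- undup W) count_mem x alpha)%N)//; last first.
    by apply: leq_sum.
  rewrite -sum1_size [leqLHS](eq_big_seq (fun i => \sum_(x <- undup W) (x == i))%N).
    rewrite exchange_big /=; apply: leq_sum => x _.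
    by rewrite -sum1_count [leqRHS]big_mkcond /=; apply: leq_sum => i _; rewrite eq_sym; case: eqP.
  move=> i ia; rewrite (bigD1_seq i) ?undup_uniq//= ?mem_undup.
    by rewrite eqxx big1 // => j /negbTE->.
  by have := sub i ia; rewrite -WV.
have [k /asboolP[alpha [leg sub] sz] kmax] := ex_maxnP P0 Pbound.
exists alpha; split=> // x Vx.
case e : (after _ _ _ x) => [[|m]|]; [by left| |by right].
have : P k.+1.
  apply/asboolP; exists (rcons alpha x); last by rewrite size_rcons sz.
  split; first by apply/legal_rcons; split=> //; exists m.+1.
  by move=> z; rewrite mem_rcons inE => /predU1P[->//|]; exact: sub.
by move=> /kmax; rewrite ltnn.
Qed.

End Legal.

(** * Flows on a half-line *)

Definition nearest_jumps (tau : instruction_array) : Prop :=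
  forall x i, [\/ tau x i = Sleep, tau x i = Jump (x - 1) | tau x i = Jump (x + 1)].

(* A direction [d] tells on which side of a reference point we work: to the
   right of it ([true]) or to the left; [back] points to that reference. *)
Definition back (d : bool) (x : int) : int := if d then x - 1 else x + 1.
Definition fwd (d : bool) (x : int) : int := if d then x + 1 else x - 1.

(** The reference is the edge between [o - 1] and [o]; both half-lines are numbered from [0] away
    from it. *)
Definition site (o : int) (d : bool) (y : nat) : int :=
  if d then o + y%:Z else o - 1 - y%:Z.

Definition site_index (o : int) (d : bool) (x : int) : nat :=
  if d then absz (x - o)%R else absz (o - 1 - x)%R.

Definition on_side (o : int) (d : bool) (x : int) : bool :=
  if d then o <= x else x < o.

Lemma siteK o d : cancel (site o d) (site_index o d).
Proof. by move=> y; rewrite /site_index /site; case: d; lia. Qed.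

Lemma on_side_site o d y : on_side o d (site o d y).
Proof. by rewrite /site /on_side; case: d; lia. Qed.

Lemma site_indexK o d x : on_side o d x -> site o d (site_index o d x) = x.
Proof. by rewrite /on_side /site /site_index; case: d; lia. Qed.

Lemma on_sideN o d x : on_side o (~~ d) x = ~~ on_side o d x.
Proof. by rewrite /on_side; case: d; rewrite /= ?ltNge// negbK. Qed.

Lemma fwd_site o d y : fwd d (site o d y) = site o d y.+1.
Proof. by rewrite /fwd /site; case: d; lia. Qed.

Lemma back_site o d y : back d (site o d y.+1) = site o d y.
Proof. by rewrite /back /site; case: d; lia. Qed.

Lemma back_site0 o d : back d (site o d 0) = site o (~~ d) 0.
Proof. by rewrite /back /site; case: d; rewrite /=; lia. Qed.

Lemma backN d x : back (~~ d) x = fwd d x.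
Proof. by case: d. Qed.

Lemma back_neq_fwd d x : Jump (back d x) <> Jump (fwd d x).
Proof. by rewrite /back /fwd; case: d => -[]; lia. Qed.

Section Neighbours.
Variable tau : instruction_array.

Lemma cnt_jumps x y z m : Jump y <> Jump z ->
  (cnt tau x (Jump y) m + cnt tau x (Jump z) m <= jumps tau x m)%N.
Proof.
move=> yz; elim: m => [//|m IH]; rewrite !cntS jumpsS.
have -> : (tau x m != Sleep) = ~~ `[< tau x m = Sleep >].
  by congr negb; apply/eqP/asboolP.
case: (tau x m =P Jump y) => [e|ny]; case: (tau x m =P Jump z) => [e'|nz].
- by case: yz; rewrite -e -e'.
- by rewrite e asboolF//; lia.
- by rewrite e' asboolF//; lia.
- by case: asboolP => _ /=; lia.
Qed.

Lemma cnt_far x y m : nearest_jumps tau -> y != x - 1 -> y != x + 1 ->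
  cnt tau y (Jump x) m = 0%N.
Proof.
move=> nn y1 y2; elim: m => [//|m IH]; rewrite cntS IH add0n.
by case: eqP => // e; case: (nn y m); rewrite e// => -[] ?; lia.
Qed.

Lemma incoming_neighbours F u x : nearest_jumps tau -> uniq F ->
  (incoming tau F u x <= cnt tau (x - 1)%R (Jump x) (u (x - 1)%R) +
                         cnt tau (x + 1)%R (Jump x) (u (x + 1)%R))%N.
Proof.
move=> nn uF; rewrite /incoming.
set f := fun y => cnt tau y (Jump x) (u y).
have once a : (\sum_(y <- F) (y == a) * f a <= f a)%N.
  rewrite -big_distrl /= -[leqRHS]mul1n leq_mul2r; apply/orP; right.
  have -> : (\sum_(y <- F) (y == a) = count_mem a F)%N.
    by rewrite -sum1_count [RHS]big_mkcond; apply: eq_bigr => y _ /=; case: eqP.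
  by rewrite count_uniq_mem// leq_b1.
rewrite (leq_trans _ (leq_add (once (x - 1)) (once (x + 1))))// -big_split.
apply: leq_sum => y _ /=; rewrite /f.
have [->|y1] := eqVneq y (x - 1); first by rewrite mul1n leq_addr.
have [->|y2] := eqVneq y (x + 1); first by rewrite mul1n leq_addl.
by rewrite cnt_far // (negbTE y1).
Qed.

Lemma neighbours_supersolution d c u x : nearest_jumps tau ->
  (c x + cnt tau (back d x) (Jump x) (u (back d x)) +
     cnt tau (fwd d x) (Jump x) (u (fwd d x)) <=
   jumps tau x (u x) + ends_asleep tau x (u x))%N ->
  supersolution tau c u x.
Proof.
move=> nn le F uF; apply: leq_trans le.
rewrite -addnA leq_add2l (leq_trans (incoming_neighbours u x nn uF))//.
by case: d; rewrite /back /fwd// addnC.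
Qed.

Lemma supersolution_neighbours c u x : supersolution tau c u x ->
  (c x + cnt tau (x - 1)%R (Jump x) (u (x - 1)%R) +
     cnt tau (x + 1)%R (Jump x) (u (x + 1)%R) <=
   jumps tau x (u x) + ends_asleep tau x (u x))%N.
Proof.
move=> /(_ [:: x - 1; x + 1]); rewrite /incoming !big_cons big_nil addn0 addnA.
by apply; rewrite /= inE andbT; apply/eqP; lia.
Qed.

End Neighbours.

Section Flow.
Variables (tau : instruction_array) (o : int) (d : bool).

Definition nback y m := cnt tau (site o d y) (Jump (back d (site o d y))) m.
Definition nfwd y m := cnt tau (site o d y) (Jump (fwd d (site o d y))) m.

(* [D y] is the net number of particles which cross towards the reference point
   the edge between the sites of coordinates [y - 1] and [y]. *)
Definition back_needed (D : nat -> nat) (U : nat -> nat) (y : nat) : nat :=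
  (if y is y'.+1 then nfwd y' (U y') + D y else D 0)%N.

(** The second clause makes [U y] the least number of instructions with enough back jumps. This
    determines the flow, and lets it be recognized from the instructions it uses. *)
Definition flow_upto (D : nat -> nat) (Y : nat) (U : nat -> nat) : Prop :=
  forall y, (y < Y)%N -> nback y (U y) = back_needed D U y /\
    forall m, (m < U y)%N -> (nback y m < back_needed D U y)%N.

(** The back jumps needed at a site depend only on [D] and on the previous site, and minimality then
    fixes [U y]; hence induction outwards. *)
Lemma flow_unique D D' Y U U' : (forall y, (y < Y)%N -> D y = D' y) ->
  flow_upto D Y U -> flow_upto D' Y U' -> forall y, (y < Y)%N -> U y = U' y.
Proof.
move=> DD' flU flU'; elim/ltn_ind => y IH yY.
have need_eq : back_needed D U y = back_needed D' U' y.
  case: y IH yY => [|y] IH yY /=; first exact: DD'.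
  by rewrite DD'// IH// (ltn_trans _ yY).
have [e lt] := flU y yY; have [e' lt'] := flU' y yY.
have [uu|uu|//] := ltngtP (U y) (U' y).
- by have := lt' _ uu; rewrite e need_eq ltnn.
- by have := lt _ uu; rewrite e' need_eq ltnn.
Qed.

Lemma flow_exists D : (forall y N, exists m, (N <= nback y m)%N) ->
  exists U, forall Y, flow_upto D Y U.
Proof.
move=> inf; pose h y N := ex_minn (inf y N).
(* The count of back jumps grows by at most one per instruction, so the least [m] reaching [N] gives
   exactly [N]. *)
have hP y N : nback y (h y N) = N /\ forall m, (m < h y N)%N -> (nback y m < N)%N.
  rewrite /h; case: ex_minnP => m Nm mmin; split; last first.
    by move=> m'; apply: contraTT; rewrite -!leqNgt; exact: mmin.
  case: m Nm mmin => [|m] Nm mmin; first by apply/eqP; rewrite eqn_leq Nm andbT.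
  apply/eqP; rewrite eqn_leq Nm andbT /nback cntS.
  have : ~~ (N <= nback y m)%N by apply/negP => /mmin; rewrite ltnn.
  by rewrite -ltnNge /nback; case: eqP => _; lia.
pose U := fix U y : nat :=
  (if y is y'.+1 then h y (nfwd y' (U y') + D y)%N else h 0%N (D 0%N)).
exists U => Y [|y] _ /=; exact: hP.
Qed.

End Flow.

(** All particles are sent out through the reference edge: [D y] counts those initially at [y] or
    beyond. This flow, extended by [0] outside the box, is a supersolution on the box. *)
Lemma box_stabilizes tau (c : int -> nat) o d n : nearest_jumps tau ->
  (forall y N, exists m, (N <= nback tau o d y m)%N) ->
  exists alpha, stabilizing tau
    [set x | on_side o d x /\ (site_index o d x < n)%N] (all_active c) alpha.
Proof.
move=> nn inf.
pose D y := (\sum_(y <= z < n) c (site o d z))%N.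
have [U flU] := flow_exists D inf.
pose u x := if on_side o d x && (site_index o d x < n)%N then U (site_index o d x) else 0%N.
have uE y : (y < n)%N -> u (site o d y) = U y.
  by move=> yn; rewrite /u on_side_site siteK yn.
apply: (@exists_stabilizing _ _ _ [seq site o d y | y <- iota 0 n] u).
  apply/seteqP; split=> [x /= /mapP[y]|x /= [xs xn]].
    by rewrite mem_iota => /andP[_ yn] ->; rewrite on_side_site siteK.
  by apply/mapP; exists (site_index o d x); rewrite ?mem_iota// site_indexK.
move=> x [xs xn]; rewrite -(site_indexK xs); move: (site_index o d x) xn => y yn {x xs}.
apply: (neighbours_supersolution (d := d)) => //.
rewrite uE//; have [Ey _] := flU n y yn.
rewrite (leq_trans _ (leq_addr _ _))//.
apply: leq_trans (cnt_jumps _ _ _ (@back_neq_fwd d (site o d y))).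
rewrite -[cnt _ _ (Jump (back _ _)) _]/(nback tau o d y (U y)).
rewrite -[cnt _ _ (Jump (fwd _ _)) _]/(nfwd tau o d y (U y)) Ey.
have Dy : (c (site o d y) + D y.+1)%N = D y by rewrite /D [RHS]big_ltn.
have inF : (cnt tau (fwd d (site o d y)) (Jump (site o d y))
             (u (fwd d (site o d y))) <= nfwd tau o d y (U y) + D y.+1)%N.
  rewrite fwd_site; have [yn'|yn'] := ltnP y.+1 n; last first.
    by rewrite /u siteK ltnNge yn' andbF.
  rewrite uE// -[in Jump _](back_site o d y).
  by have [+ _] := flU n y.+1 yn'; rewrite /nback => ->.
have inB : (cnt tau (back d (site o d y)) (Jump (site o d y))
             (u (back d (site o d y))) + D y <= back_needed tau o d D U y)%N.
  case: y yn {Ey Dy inF} => [|y] yn /=.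
    by rewrite /u back_site0 -[d in on_side _ d _]negbK on_sideN on_side_site.
  by rewrite back_site uE ?(ltn_trans _ yn)// -[in Jump _]fwd_site.
lia.
Qed.

(** * The box and the particles that leave it *)

Definition box_left (n : nat) : int := - (n.-1./2)%:Z.

Lemma boxE n : (0 < n)%N ->
  box n = [set x | box_left n <= x < box_left n + n%:Z].
Proof.
move=> n0; apply/seteqP; suff eqb x : (box n x : Prop) =
    ((- n%:Z < x * 2) && (x * 2 <= n%:Z) : Prop).
  by split=> x; rewrite eqb /= /box_left; lia.
rewrite /box /= -mulNr ltr_pdivrMr// ler_pdivlMr//.
rewrite (_ : x%:~R * 2 = (x * 2)%:~R :> rat); last by rewrite intrM.
rewrite (_ : - n%:R = (- n%:Z)%:~R :> rat); last by rewrite mulrNz.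
by rewrite (_ : n%:R = n%:Z%:~R :> rat)// ltr_int ler_int.
Qed.

Section Escape.
Variables (tau : instruction_array) (V : set int) (c : int -> nat).
Hypothesis c0 : forall x, ~ V x -> c x = 0%N.

Lemma finite_support_update xi x s :
  finite_set [set y | particles (xi y) != 0%N] ->
  finite_set [set y | particles (update xi x s y) != 0%N].
Proof.
move=> fin; apply: (@sub_finite_set _ _ ([set y | particles (xi y) != 0%N] `|` [set x])).
  by move=> y /=; rewrite /update; case: (y =P x) => [yx|_] ?; [right|left].
by rewrite finite_setU; split => //; exact: finite_set1.
Qed.

Lemma finite_support_after alpha : finite_set V ->
  finite_set [set y | particles (after tau (all_active c) alpha y) != 0%N].
Proof.
move=> finV; elim/last_ind: alpha => [|alpha x IH].
  apply: sub_finite_set finV => x /=; rewrite /after /= => cx.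
  by apply: contrapT => /c0 cx0; rewrite cx0 in cx.
rewrite after_rcons; case: (tau x _) => [|z] /=.
  by case: (after _ _ _ x) => [[|[|k]]|]//; exact: finite_support_update.
by apply: finite_support_update; exact: finite_support_update.
Qed.

(** By the abelian property the sequence picked by [xget] does not matter. The second alternative is
    the default, where the initial configuration is untouched and vanishes outside [V]. *)
Lemma escaped_eq0 : finite_set V ->
  escaped tau V c = 0%N <->
  ((exists2 alpha, stabilizing tau V (all_active c) alpha &
     forall x, ~ V x -> particles (after tau (all_active c) alpha x) = 0%N) \/
   ~ exists alpha, stabilizing tau V (all_active c) alpha).
Proof.
move=> finV; rewrite /escaped /stabilized.
set S := stabilizing tau V (all_active c).
have [[alpha0 Sa0]|noS] := pselect (exists alpha, S alpha); last first.
  split=> [_|_]; first by right.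
  rewrite fsbig1// => x /c0 cx0.
  rewrite xgetPN /after /= /all_active ?cx0//.
  by move=> alpha Sa; apply: noS; exists alpha.
have Sa : S (xget [::] S) by apply: (@xgetPex _ [::] S); exists alpha0.
set alpha := xget [::] S in Sa *.
split=> [sum0|].
  left; exists alpha => // x Vx.
  move: sum0; rewrite fsbig_supp.
  set A := (_ `&` _) => sum0; apply: contrapT => px.
  move: sum0; rewrite (fsbigD1 x) /=; first by lia.
    apply: sub_finite_set (finite_support_after alpha finV) => y [_ /=] py.
    exact/eqP.
  by split.
move=> [[beta Sb beta0]|]; last by case; exists alpha0.
rewrite fsbig1// => x Vx; rewrite -(beta0 x Vx).
exact: stabilizing_particles Sa Sb.
Qed.

End Escape.

Lemma sum_box n (c : int -> nat) : (0 < n)%N ->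
  (\big[addn/0%N]_(x \in box n) c x = \sum_(z < n) c (box_left n + z%:Z)%R)%N.
Proof.
move=> n0.
have inj : injective (fun z : nat => box_left n + z%:Z) by move=> a b; lia.
rewrite -(big_mkord xpredT (fun z => c (box_left n + z%:Z)%R)) /index_iota subn0.
rewrite -(big_map (fun z : nat => box_left n + z%:Z) xpredT c).
apply: fsbig_fwiden.
- rewrite boxE// => x /= xb; apply/mapP; exists `|(x - box_left n)%R|%N.
    by rewrite mem_iota; lia.
  by lia.
- by rewrite map_inj_uniq ?iota_uniq.
- move=> x [/= /mapP[z]]; rewrite mem_iota boxE// => zn ->.
  by case=> /=; lia.
Qed.

(** * Independence and almost sure events for instruction arrays *)

(** The alphabet is made countable, so that events can be split over the values of a coordinate. *)
Definition instruction_code (a : instruction) : option int :=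
  if a is Jump y then Some y else None.
Definition instruction_decode (o : option int) : instruction :=
  if o is Some y then Jump y else Sleep.
Lemma instruction_codeK : cancel instruction_code instruction_decode.
Proof. by case. Qed.
HB.instance Definition _ := CanIsCountable instruction_codeK.

Definition key : Type := (int * nat)%type.

Definition cyl (s : seq key) (C : key -> set instruction) : set arrays :=
  [set tau | forall z, z \in s -> C z (tau z.1 z.2)].

(** An event supported on [K] is its own preimage under this map, so that support can be handled
    through image measures. *)
Definition keep (K : pred key) (tau : arrays) : arrays :=
  fun x i => if K (x, i) then tau x i else Sleep.

Definition supported (K : pred key) (A : set arrays) : Prop :=
  forall tau tau' : arrays, (forall z, K z -> tau z.1 z.2 = tau' z.1 z.2) ->
    A tau -> A tau'.

Lemma measurable_at (x : int) (i : nat) (B : set instruction) :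
  measurable [set tau : arrays | B (tau x i)].
Proof.
have -> : [set tau : arrays | B (tau x i)] =
    \bigcup_a [set tau : arrays | tau x i = a /\ B a].
  by apply/seteqP; split=> [tau Bt|tau [a _ [<-]]]//; exists (tau x i).
apply: countable_bigcupT_measurable => // a.
have [Ba|Ba] := pselect (B a).
  rewrite (_ : [set _ | _] = [set tau : arrays | tau x i = a]).
    by apply: sub_sigma_algebra; exists x, i, a.
  by apply/seteqP; split=> [tau []|].
rewrite (_ : [set _ | _] = set0)//.
by rewrite -subset0 => tau [].
Qed.

Lemma measurable_cyl s C : measurable (cyl s C).
Proof.
elim: s => [|z s IH].
  by rewrite (_ : cyl _ _ = setT)//; apply/seteqP; split.
rewrite (_ : cyl _ _ = [set tau : arrays | C z (tau z.1 z.2)] `&` cyl s C).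
  by apply: measurableI => //; exact: measurable_at.
apply/seteqP; split=> tau.
  move=> h; split; first by apply: (h z); rewrite mem_head.
  by move=> t ts; apply: h; rewrite inE ts orbT.
by move=> [h1 h2] t; rewrite inE => /predU1P[->//|]; exact: h2.
Qed.

(** The event is a countable union of cylinders, one for each list of values on [s]. Measurability
    thus follows from knowing which finitely many instructions are read. *)
Lemma measurable_supported_seq (s : seq key) (A : set arrays) :
  supported (mem s) A -> measurable A.
Proof.
move=> supA; pose val (tau : arrays) := [seq tau z.1 z.2 | z <- s].
have valE tau tau' : val tau = val tau' ->
    forall z, z \in s -> tau z.1 z.2 = tau' z.1 z.2.
  by move=> /eq_in_map.
have -> : A = \bigcup_v [set tau | val tau = v /\ exists2 tau', A tau' & val tau' = v].
  apply/seteqP; split=> [tau At|tau [v _ [vE [tau' At' v'E]]]].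
    by exists (val tau) => //; split=> //; exists tau.
  by apply: supA At' => z; apply: valE; rewrite vE.
apply: countable_bigcupT_measurable => // v.
have [[tau' At' v'E]|no] := pselect (exists2 tau', A tau' & val tau' = v); last first.
  by rewrite (_ : [set _ | _] = set0)// -subset0 => tau [].
rewrite (_ : [set _ | _] = cyl s (fun z => [set tau' z.1 z.2])).
  exact: measurable_cyl.
apply/seteqP; split=> [tau [vE _]|tau h].
  by move=> z zs /=; apply: valE zs; rewrite vE.
split; last by exists tau'.
by rewrite -v'E; apply/eq_in_map => z /h.
Qed.

Lemma measurable_relabel (h : arrays -> arrays) :
  (forall x i, exists z f, forall tau, h tau x i = f (tau z.1 z.2)) ->
  measurable_fun setT h.
Proof.
move=> hE; apply: (@measurability _ _ arrays arrays setT h array_cylinders) => //.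
move=> _ [_ [x [i [a ->]]] <-]; rewrite setTI.
have [z [f fE]] := hE x i.
rewrite (_ : _ @^-1` _ = [set tau : arrays | [set b | f b = a] (tau z.1 z.2)]).
  exact: measurable_at.
by apply/seteqP; split=> tau /=; rewrite fE.
Qed.

Lemma measurable_keep K : measurable_fun setT (keep K).
Proof.
apply: measurable_relabel => x i; exists (x, i).
by exists (fun a => if K (x, i) then a else Sleep).
Qed.

Lemma supportedE K A : supported K A -> A = keep K @^-1` A.
Proof.
move=> sA; apply/seteqP; split=> tau; apply: sA => z Kz;
  by rewrite /keep -surjective_pairing Kz.
Qed.

Lemma cylI s C t C' : cyl s C `&` cyl t C' =
  cyl (s ++ t) (fun z => [set a | (z \in s -> C z a) /\ (z \in t -> C' z a)]).
Proof.
apply/seteqP; split=> [tau [h1 h2] z _ /=|tau h]; first by split; [exact: h1|exact: h2].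
by split=> z zs; have /= := h z; rewrite mem_cat zs ?orbT => /(_ isT)[]; [move=> + _|]; auto.
Qed.

Lemma cyl_undup s C : cyl s C = cyl (undup s) C.
Proof. by apply/seteqP; split=> tau h z zs; apply: h; rewrite ?mem_undup// -mem_undup. Qed.

Section ArrayMeasures.
Context {R : realType}.

(** Cylinders are stable under intersection and generate the sigma-algebra. *)
Lemma arrays_measure_ext (m1 m2 : {measure set arrays -> \bar R}) :
  (m1 setT < +oo)%E -> (forall s C, uniq s -> m1 (cyl s C) = m2 (cyl s C)) ->
  forall A, measurable A -> m1 A = m2 A.
Proof.
move=> fin eqm A mA.
pose G : set (set arrays) := [set A | exists s C, A = cyl s C].
have Gm : G `<=` measurable by move=> _ [s [C ->]]; exact: measurable_cyl.
have GT : G setT by exists [::], (fun=> setT); apply/seteqP; split.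
apply: (@g_sigma_algebra_measure_unique _ _ _ G Gm (fun=> setT)) => //.
- by apply/seteqP; split=> // tau _; exists 0%N.
- move=> _ _ [s [C ->]] [t [C' ->]]; rewrite cylI.
  by eexists; eexists.
- by move=> _ [s [C ->]]; rewrite cyl_undup; apply: eqm; exact: undup_uniq.
move: A mA; apply: sub_sigma_algebra2.
move=> _ [x [i [a ->]]]; exists [:: (x, i)], (fun=> [set a]).
apply/seteqP; split=> tau /=.
  by move=> e z; rewrite inE => /eqP->.
by move=> /(_ (x, i)); rewrite mem_head => /(_ isT).
Qed.

End ArrayMeasures.

Section Independence.
Context {R : realType} (lambda : R) (p : int -> int -> R).
Variable Q : probability arrays R.
Hypothesis lawQ : array_law lambda p Q.

Definition image_measure d d' (T : measurableType d) (T' : measurableType d')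
    (m : {measure set T -> \bar R}) (h : T -> T') (mh : measurable_fun setT h) :
    {measure set T' -> \bar R} :=
  measure_function_pushforward__canonical__measure_function_Measure m mh.

Lemma measurable_preimageT d d' (T : measurableType d) (T' : measurableType d')
    (h : T -> T') A :
  measurable_fun setT h -> measurable A -> measurable (h @^-1` A).
Proof. by move=> mh mA; rewrite -[_ @^-1` _]setTI; exact: mh. Qed.

(** As functions of [S] both sides are finite measures, the images under [h] of [Q] restricted to
    [Y] and of a multiple of [Q]; comparing them on cylinders is enough. *)
Lemma indep_extend (h : arrays -> arrays) Y : measurable_fun setT h -> measurable Y ->
  (forall s C, uniq s ->
    Q (h @^-1` cyl s C `&` Y) = (Q (h @^-1` cyl s C) * Q Y)%E) ->
  forall S, measurable S -> Q (h @^-1` S `&` Y) = (Q (h @^-1` S) * Q Y)%E.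
Proof.
move=> mh mY eqc S mS.
have QYfin : Q Y \is a fin_num by exact: fin_num_measure.
pose r : {nonneg R} := NngNum (fine_ge0 (measure_ge0 Q Y)).
have rE : (r%:num)%:E = Q Y by rewrite /= fineK.
have ext := @arrays_measure_ext R (image_measure (mrestr Q mY) mh)
   (mscale r (image_measure Q mh)).
rewrite -[LHS]/(image_measure (mrestr Q mY) mh S) ext//.
- by rewrite /= /mscale rE muleC.
- rewrite /= /pushforward /mrestr (@le_lt_trans _ _ (Q setT))//; last first.
    by rewrite probability_setT ltry.
  by apply: le_measure; rewrite ?inE//; apply: measurableI => //; exact: measurable_preimageT.
- by move=> s C us; rewrite /= /mscale rE muleC; exact: eqc.
Qed.

Lemma Q_cyl s C : uniq s ->
  Q (cyl s C) = (\prod_(z <- s) Q [set tau : arrays | C z (tau z.1 z.2)])%E.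
Proof. by case: lawQ => indep _; exact: indep. Qed.

(** Coordinates outside [K] have become [Sleep]: their constraints all hold and drop out here, while
    in the next lemma one of them fails and the event is empty. *)
Lemma keep_cyl K s C : (forall z, z \in s -> ~~ K z -> C z Sleep) ->
  keep K @^-1` cyl s C = cyl [seq z <- s | K z] C.
Proof.
move=> CS; apply/seteqP; split=> tau h z.
  rewrite mem_filter => /andP[Kz zs]; have := h z zs.
  by rewrite /keep -surjective_pairing Kz.
move=> zs; rewrite /keep -surjective_pairing; case: ifPn => Kz.
  by apply: h; rewrite mem_filter Kz.
exact: CS.
Qed.

Lemma keep_cyl0 K s C : ~ (forall z, z \in s -> ~~ K z -> C z Sleep) ->
  keep K @^-1` cyl s C = set0.
Proof.
move=> CS; rewrite -subset0 => tau h; apply: CS => z zs Kz.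
by have := h z zs; rewrite /keep -surjective_pairing (negbTE Kz).
Qed.

Lemma indep_cyl K s t C C' : uniq s -> uniq t ->
  Q (keep K @^-1` cyl s C `&` keep (predC K) @^-1` cyl t C') =
  (Q (keep K @^-1` cyl s C) * Q (keep (predC K) @^-1` cyl t C'))%E.
Proof.
move=> us ut.
have [CS|CS] := pselect (forall z, z \in s -> ~~ K z -> C z Sleep); last first.
  by rewrite (keep_cyl0 CS) set0I !measure0 mul0e.
have [CT|CT] := pselect (forall z, z \in t -> ~~ predC K z -> C' z Sleep); last first.
  by rewrite (keep_cyl0 CT) setI0 !measure0 mule0.
rewrite !keep_cyl// cylI; set s' := seq.filter _ s; set t' := seq.filter _ t.
have us' : uniq s' by exact: filter_uniq.
have ut' : uniq t' by exact: filter_uniq.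
have disj z : z \in s' -> z \in t' -> False.
  by rewrite !mem_filter /= => /andP[-> _].
rewrite !Q_cyl//; last first.
  rewrite cat_uniq us' ut' andbT /=; apply/hasPn => z zt; apply/negP => zs.
  exact: disj zs zt.
rewrite big_cat /=; congr (_ * _)%E; apply: eq_big_seq => z zs; congr (Q _);
  apply/seteqP; split=> tau /=.
- by case=> + _; apply.
- by move=> h; split=> // zt; case: (disj z zs zt).
- by case=> _; apply.
- by move=> h; split=> // zt; case: (disj z zt zs).
Qed.

(** Extending from cylinders in one event and then in the other reduces the claim to disjoint lists
    of coordinates. *)
Lemma indep_supported K X Y : measurable X -> measurable Y ->
  supported K X -> supported (predC K) Y -> Q (X `&` Y) = (Q X * Q Y)%E.
Proof.
move=> mX mY /supportedE sX /supportedE sY; rewrite sX.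
apply: indep_extend => //; first exact: measurable_keep.
move=> s C us; rewrite sY setIC muleC.
apply: indep_extend => //; first exact: measurable_keep.
  by apply: measurable_preimageT; [exact: measurable_keep|exact: measurable_cyl].
by move=> t C' ut; rewrite setIC muleC; exact: indep_cyl.
Qed.

Lemma marginal_eq (z z' : key) (f g : instruction -> instruction) :
  cancel f g -> cancel g f ->
  (forall a, instruction_prob lambda p z'.1 a = instruction_prob lambda p z.1 (f a)) ->
  forall B, Q [set tau : arrays | B (f (tau z'.1 z'.2))] =
            Q [set tau : arrays | B (tau z.1 z.2)].
Proof.
move=> fK gK fprob B; have [_ marg] := lawQ.
pose Bk (k : nat) : set instruction := [set a | pickle a = k /\ B a].
have decomp (w : arrays -> instruction) :
    [set tau | B (w tau)] = \bigcup_k [set tau | Bk k (w tau)].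
  by apply/seteqP; split=> [tau Bt|tau [k _ []]]//; exists (pickle (w tau)).
have triv (w : arrays -> instruction) : trivIset setT (fun k => [set tau | Bk k (w tau)]).
  by apply/trivIsetP => i j _ _ /eqP ij; rewrite -subset0 => tau [[+ _] [+ _]] => -> /ij.
rewrite (decomp (fun tau => f (tau z'.1 z'.2))) (decomp (fun tau => tau z.1 z.2)).
rewrite !measure_bigcup//; last 2 first.
- by move=> k _; exact: measurable_at.
- by move=> k _; exact: (measurable_at z'.1 z'.2 (f @^-1` Bk k)).
apply: eq_eseriesr => k _.
have [[a [ak Ba]]|no] := pselect (exists a, Bk k a); last first.
  by congr (Q _); apply/seteqP; split=> tau h; case: no; eexists; exact: h.
have Bka b : Bk k b <-> b = a.
  split=> [[bk _]|->//]; apply: (pcan_inj pickleK); congruence.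
transitivity (Q [set tau : arrays | tau z'.1 z'.2 = g a]).
  by congr (Q _); apply/seteqP; split=> tau /=; rewrite Bka;
    [move=> <-; rewrite fK|move=> ->; rewrite gK].
transitivity (Q [set tau : arrays | tau z.1 z.2 = a]); last first.
  by congr (Q _); apply/seteqP; split=> tau /=; rewrite Bka.
by rewrite !marg fprob gK.
Qed.

Definition relabel (K : pred key) (phi : key -> key)
    (f : key -> instruction -> instruction) (tau : arrays) : arrays :=
  fun x i => if K (x, i) then f (x, i) (tau (phi (x, i)).1 (phi (x, i)).2) else Sleep.

Lemma measurable_relabelling K phi f : measurable_fun setT (relabel K phi f).
Proof.
apply: measurable_relabel => x i; exists (phi (x, i)).
by exists (fun a => if K (x, i) then f (x, i) a else Sleep).
Qed.

(** Distinct coordinates of [K] are read at distinct places and the renaming matches the marginals,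
    so the relabelled coordinates are again independent with the original law. *)
Lemma relabel_law K phi f g S : measurable S -> supported K S ->
  {in K &, injective phi} ->
  (forall z, cancel (f z) (g z)) -> (forall z, cancel (g z) (f z)) ->
  (forall z a, K z -> instruction_prob lambda p (phi z).1 a =
                      instruction_prob lambda p z.1 (f z a)) ->
  Q (relabel K phi f @^-1` S) = Q S.
Proof.
move=> mS /supportedE sS phi_inj fK gK fprob; rewrite [in RHS]sS.
apply: (@arrays_measure_ext R (image_measure Q (measurable_relabelling K phi f))
   (image_measure Q (measurable_keep K))) => //.
  by rewrite /= /pushforward preimage_setT probability_setT ltry.
move=> s C us; rewrite /= /pushforward.
have [CS|CS] := pselect (forall z, z \in s -> ~~ K z -> C z Sleep); last first.
  rewrite keep_cyl0// (_ : _ @^-1` _ = set0) ?measure0//.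
  rewrite -subset0 => tau h; apply: CS => z zs Kz.
  by have := h z zs; rewrite /relabel -surjective_pairing (negbTE Kz).
rewrite keep_cyl// Q_cyl ?filter_uniq//.
set s' := seq.filter _ s.
have s'K z : z \in s' -> K z by rewrite mem_filter => /andP[].
(* The constraint carried to the coordinate [w]; injectivity of [phi] leaves at most one [z] to
   consider. *)
pose C' w := [set a | forall z, z \in s' -> phi z = w -> C z (f z a)].
have -> : relabel K phi f @^-1` cyl s C = cyl (map phi s') C'.
  apply/seteqP; split=> tau h.
    move=> _ /mapP[z zs' ->] z' z's'; have Kz' := s'K _ z's'.
    move=> /(phi_inj _ _ Kz' (s'K _ zs')) zz'; rewrite -zz'.
    have := h z'; rewrite /relabel -surjective_pairing Kz'; apply.
    by move: z's'; rewrite mem_filter => /andP[].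
  move=> z zs; rewrite /relabel -surjective_pairing; case: ifPn => Kz; last exact: CS.
  have zs' : z \in s' by rewrite mem_filter Kz.
  by apply: (h (phi z)) => //; exact: map_f.
rewrite Q_cyl; last first.
  rewrite map_inj_in_uniq ?filter_uniq// => z z' /s'K Kz /s'K Kz'; exact: phi_inj.
rewrite big_map; apply: eq_big_seq => z zs'.
rewrite -(@marginal_eq z (phi z) (f z) (g z))//; last by move=> a; apply: fprob; exact: s'K.
congr (Q _); apply/seteqP; split=> tau /=; first by move=> /(_ z zs' erefl).
move=> h z' z's' /(phi_inj _ _ (s'K _ z's') (s'K _ zs')) ->; exact: h.
Qed.

End Independence.

Lemma cnt_ext (tau tau' : instruction_array) x x' a a' m :
  (forall i, (i < m)%N -> (tau x i == a) = (tau' x' i == a')) ->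
  cnt tau x a m = cnt tau' x' a' m.
Proof.
move=> e; rewrite /cnt; apply: eq_in_count => i; rewrite mem_iota; exact: e.
Qed.

Lemma measurable_cnt x a m (B : set nat) :
  measurable [set tau : arrays | B (cnt tau x a m)].
Proof.
apply: (@measurable_supported_seq [seq (x, i) | i <- iota 0 m]).
move=> tau tau' e; rewrite /= (@cnt_ext tau tau' x x a a m)// => i im.
by rewrite (e (x, i))//; apply: map_f; rewrite mem_iota.
Qed.

Section AlmostSure.
Context {R : realType} (lambda : R) (p : int -> int -> R).
Variable Q : probability arrays R.

Definition sure (E : set arrays) : Prop := measurable E /\ Q (~` E) = 0%E.

Lemma sure_sub E F : sure E -> measurable F -> E `<=` F -> sure F.
Proof.
move=> [mE E0] mF EF; split=> //.
by apply: (subset_measure0 _ _ _ E0) => //; [exact: measurableC..|exact: subsetC].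
Qed.

Lemma sure_bigcap (U : countType) (E : U -> set arrays) :
  (forall k, sure (E k)) -> sure (\bigcap_k E k).
Proof.
move=> sE.
have mC k : measurable (~` E k) by apply: measurableC; case: (sE k).
have mU : measurable (\bigcup_k ~` E k) by exact: countable_bigcupT_measurable.
split; first by rewrite -[X in measurable X]setCK setC_bigcap; exact: measurableC.
rewrite setC_bigcap; apply: measure_negligible => //.
pose F k := if (unpickle k : option U) is Some u then ~` E u else set0.
apply: (@negligibleS _ _ _ _ (\bigcup_k F k)).
  by move=> tau [u _ Eu]; exists (pickle u) => //; rewrite /F pickleK.
apply: negligible_bigcup => k; rewrite /F.
case: (unpickle k) => [u|]; last exact: negligible_set0.
by apply/negligibleP => //; case: (sE u).
Qed.

Lemma sureI E F : sure E -> sure F -> sure (E `&` F).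
Proof.
move=> sE sF; have := @sure_bigcap bool (fun b => if b then E else F).
rewrite (_ : \bigcap_b _ = E `&` F); first by apply=> -[].
apply/seteqP; split=> [tau h|tau [h1 h2] []//].
by split; [exact: (h true)|exact: (h false)].
Qed.

Lemma sure_setI E A : sure E -> measurable A -> Q (A `&` E) = Q A.
Proof.
move=> [mE E0] mA; rewrite [RHS](measureDI Q mA mE) [X in (X + _)%E](_ : _ = 0%E) ?add0e//.
apply: (subset_measure0 _ _ _ E0) => //; first exact: measurableD.
exact: measurableC.
Qed.

Lemma sure_le E A B : sure E -> measurable A -> measurable B ->
  A `&` E `<=` B -> (Q A <= Q B)%E.
Proof.
move=> sE mA mB sub; rewrite -(sure_setI sE mA); apply: le_measure; rewrite ?inE//.
by apply: measurableI => //; case: sE.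
Qed.

Hypothesis lawQ : array_law lambda p Q.

Lemma sure_neq x i a : instruction_prob lambda p x a = 0 ->
  sure [set tau : arrays | tau x i <> a].
Proof.
move=> prob0; split; first exact: (measurable_at x i (~` [set a])).
rewrite (_ : ~` _ = [set tau : arrays | tau x i = a]); last first.
  by apply/seteqP; split=> tau /= => [/contrapT|e]//; rewrite e.
by case: lawQ => _ ->; rewrite prob0.
Qed.

Lemma prob_avoid x a (N M : nat) :
  Q [set tau : arrays | forall i, (N <= i < N + M)%N -> tau x i <> a] =
  ((1 - instruction_prob lambda p x a) ^+ M)%:E.
Proof.
rewrite (_ : [set _ | _] = cyl [seq (x, i) | i <- iota N M] (fun=> ~` [set a])).
  rewrite (Q_cyl lawQ); last by rewrite map_inj_uniq ?iota_uniq// => i j [].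
  rewrite big_map (eq_bigr (fun=> (1 - instruction_prob lambda p x a)%:E)).
    rewrite -/(iota N M) prodEFin big_const_seq count_predT size_iota.
    by rewrite iter_mulr_1.
  move=> i _ /=; rewrite (_ : [set _ | _] = ~` [set tau : arrays | tau x i = a])//.
  rewrite probability_setC; last exact: (measurable_at x i [set a]).
  by case: lawQ => _ ->.
apply/seteqP; split=> tau h.
  by move=> _ /mapP[i iN ->]; apply: h; rewrite mem_iota in iN.
by move=> i iN; apply: (h (x, i)); apply: map_f; rewrite mem_iota.
Qed.

(** Missing [a] at all indices from [N] on has probability at most [(1 - r) ^+ M] for every [M],
    hence zero. Occurrences beyond every [N] then make the count unbounded. *)
Lemma sure_often x a : 0 < instruction_prob lambda p x a <= 1 ->
  sure [set tau : arrays | forall N, exists m, (N <= cnt tau x a m)%N].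
Proof.
move=> /andP[a0 a1].
pose E N := [set tau : arrays | exists i, (N <= i)%N /\ tau x i = a].
have mE N : measurable (E N).
  rewrite (_ : E N = \bigcup_i [set tau : arrays | (N <= i)%N /\ tau x i = a]).
    apply: bigcupT_measurable => i; exact: (measurable_at x i [set b | (N <= i)%N /\ b = a]).
  by apply/seteqP; split=> tau [i]; [exists i|move=> _ ?; exists i].
have sE N : sure (E N).
  split=> //.
  have mC := measurableC (mE N).
  have Cfin : Q (~` E N) \is a fin_num by exact: fin_num_measure.
  apply/eqP; rewrite eq_le measure_ge0// andbT -(fineK Cfin) lee_fin.
  set r := instruction_prob lambda p x a in a0 a1.
  have cv : (1 - r) ^+ M @[M --> \oo] --> (0 : R).
    by apply: cvg_expr; rewrite ger0_norm; lra.
  rewrite -(cvg_lim _ cv)//; apply: limr_ge; first by apply/cvg_ex; exists 0.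
  near=> M; rewrite -lee_fin fineK// -(prob_avoid x a N).
  apply: le_measure; rewrite ?inE//.
    apply: (@measurable_supported_seq [seq (x, i) | i <- iota N M]).
    move=> tau tau' e h i iN; rewrite -(e (x, i)); first exact: h.
    by apply: map_f; rewrite mem_iota.
  by move=> tau nE i /andP[Ni _] e; apply: nE; exists i.
apply: (sure_sub (sure_bigcap sE)).
  rewrite (_ : [set _ | _] = \bigcap_N \bigcup_m
      [set tau : arrays | (N <= cnt tau x a m)%N]); last first.
    apply/seteqP; split=> tau h N; first by move=> _; have [m] := h N; exists m.
    by have [m] := h N Logic.I; exists m.
  apply: bigcapT_measurable => N; apply: bigcupT_measurable => m.
  exact: (measurable_cnt x a m [set k | (N <= k)%N]).
move=> tau often; elim=> [|N [m IH]]; first by exists 0%N.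
have [i [mi e]] := often m Logic.I.
exists i.+1; rewrite cntS e eqxx addn1 ltnS (leq_trans IH)//.
exact: cnt_mono.
Unshelve. all: by end_near.
Qed.

Lemma sure_nearest : nearest_neighbour p -> sure [set tau : arrays | nearest_jumps tau].
Proof.
move=> nn; pose E (w : int * nat * int) := [set tau : arrays |
  (w.2 != w.1.1 - 1) && (w.2 != w.1.1 + 1) -> tau w.1.1 w.1.2 <> Jump w.2].
have sE w : sure (E w).
  have [far|near] := boolP ((w.2 != w.1.1 - 1) && (w.2 != w.1.1 + 1)); last first.
    rewrite /E (_ : [set _ | _] = setT); last first.
      by apply/seteqP; split=> // tau _ h; rewrite h in near.
    by split=> //; rewrite setCT measure0.
  rewrite /E far (_ : [set _ | _] = [set tau : arrays | tau w.1.1 w.1.2 <> Jump w.2]).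
    by apply: sure_neq; rewrite /= nn ?mul0r//; lia.
  by apply/seteqP; split=> tau h //; exact: (h isT).
rewrite (_ : [set _ | _] = \bigcap_w E w); first exact: sure_bigcap.
apply/seteqP; split=> [tau nj [[x i] y] _ /andP[/= /eqP y1 /eqP y2] e|tau h x i].
  by case: (nj x i); rewrite e// => -[].
case e : (tau x i) => [|y]; first by constructor 1.
have := h (x, i, y) Logic.I; rewrite /E /= e.
have [->|] := eqVneq y (x - 1); first by constructor 2.
have [->|] := eqVneq y (x + 1); first by constructor 3.
by move=> _ _ /(_ isT).
Qed.

End AlmostSure.

(** * Stabilization without exit *)

Section Confinement.
Variables (o : int) (n : nat) (eta : int -> nat).

Definition in_box (x : int) : bool := (o <= x) && (x < o + n%:Z).

(* An odometer on the box is stored as a list, so as to range over a countable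
   type. *)
Definition box_odometer (w : seq nat) (x : int) : nat :=
  if in_box x then nth 0%N w (site_index o true x) else 0%N.

(** Stabilization of [eta] in the box without exit, expressed by a candidate odometer rather than by
    topplings, so that it can be moved to any slot and superposed on a flow. The last two clauses
    forbid exits at the ends. *)
Definition confined_by (tau : instruction_array) (w : seq nat) : Prop :=
  let v := box_odometer w in
  [/\ forall x, in_box x ->
        (eta x + cnt tau (x - 1)%R (Jump x) (v (x - 1)%R)
               + cnt tau (x + 1)%R (Jump x) (v (x + 1)%R)
         <= jumps tau x (v x) + ends_asleep tau x (v x))%N,
      cnt tau o (Jump (o - 1)) (v o) = 0%N &
      cnt tau (o + n%:Z - 1) (Jump (o + n%:Z)) (v (o + n%:Z - 1)) = 0%N].

Definition confined : set arrays := [set tau | exists w, confined_by tau w].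

Lemma confined_neighbours d tau w x : confined_by tau w -> in_box x ->
  let v := box_odometer w in
  (eta x + cnt tau (back d x) (Jump x) (v (back d x))
         + cnt tau (fwd d x) (Jump x) (v (fwd d x))
   <= jumps tau x (v x) + ends_asleep tau x (v x))%N.
Proof.
move=> [+ _ _] xb => /(_ x xb); case: d => //=.
by rewrite /back /fwd addnAC.
Qed.

Lemma stabilizing_confined tau alpha : (forall x, ~~ in_box x -> eta x = 0%N) ->
  (0 < n)%N ->
  stabilizing tau [set x | in_box x] (all_active eta) alpha ->
  (forall x, ~~ in_box x -> particles (after tau (all_active eta) alpha x) = 0%N) ->
  confined tau.
Proof.
move=> eta0 n0 sa out; pose w := [seq count_mem (site o true z) alpha | z <- iota 0 n].
exists w; pose v := box_odometer w.
have [sub leg _] := sa.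
have vE x : v x = count_mem x alpha.
  rewrite /v /box_odometer; case: ifPn => xb.
    have xn : (site_index o true x < n)%N by move: xb; rewrite /in_box /site_index; lia.
    rewrite (nth_map 0%N) ?size_iota// nth_iota// add0n site_indexK//.
    by move: xb; rewrite /in_box /on_side; lia.
  by apply/esym/count_memPn/negP => /sub; rewrite /= (negbTE xb).
have vfun : v = (fun x => count_mem x alpha) by exact/funext.
(* No site outside the box is toppled, so by mass balance a jump out would leave a particle
   there. *)
have noexit x y : ~~ in_box x -> cnt tau y (Jump x) (v y) = 0%N.
  move=> xb; set F := undup (y :: alpha).
  have uF : uniq F by rewrite undup_uniq.
  have aF : {subset alpha <= F} by move=> z za; rewrite mem_undup inE za orbT.
  have := particles_conservation x uF aF leg.
  rewrite (out x xb) (eta0 x xb) (count_memPn _); last first.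
    by apply/negP => /sub; rewrite /= (negbTE xb).
  rewrite -vfun /incoming (bigD1_seq y) ?undup_uniq//=; first by rewrite -[jumps _ _ 0]/0%N; lia.
  by rewrite mem_undup mem_head.
split; [|by apply: noexit; rewrite /in_box; lia..].
move=> x xb; apply: supersolution_neighbours; rewrite -/v vfun.
exact: stable_supersolution sa xb.
Qed.

Lemma confined_supported : supported (fun z => in_box z.1) confined.
Proof.
move=> tau tau' e [w [h1 h2 h3]]; exists w.
have ce x y : cnt tau x (Jump y) (box_odometer w x) =
              cnt tau' x (Jump y) (box_odometer w x).
  rewrite /box_odometer; case: ifP => // xb.
  by apply: cnt_ext => i _; rewrite (e (x, i)).
split; rewrite -?ce// => x xb; rewrite -!ce (leq_trans (h1 x xb))//.
rewrite (_ : jumps tau x _ = jumps tau' x (box_odometer w x)); last first.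
  by apply: eq_count => i; rewrite (e (x, i)).
by rewrite /ends_asleep (e (x, _)).
Qed.

(** There are countably many lists [w], and for each of them finitely many instructions are read. *)
Lemma measurable_confined : measurable confined.
Proof.
rewrite (_ : confined = \bigcup_w [set tau : arrays | confined_by tau w]); last first.
  by apply/seteqP; split=> tau [w]; [exists w|move=> _ ?; exists w].
apply: countable_bigcupT_measurable => // w.
apply: (@measurable_supported_seq
  [seq (site o true z, i) | z <- iota 0 n, i <- iota 0 (\max_(k <- w) k).+1]).
move=> tau tau' e.
have {}e x i : in_box x -> (i <= box_odometer w x)%N -> tau x i = tau' x i.
  move=> xb iw; apply: (e (x, i)).
  apply/allpairsP; exists (site_index o true x, i); split.
  - by rewrite mem_iota /=; move: xb; rewrite /in_box /site_index; lia.
  - rewrite mem_iota [_.2]/= add0n ltnS (leq_trans iw)// /box_odometer xb.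
    have [kw|kw] := ltnP (site_index o true x) (size w); last by rewrite nth_default.
    by apply: (@leq_bigmax_seq _ _ xpredT id) => //; exact: mem_nth.
  - by rewrite site_indexK// /on_side; move: xb; rewrite /in_box; lia.
have ce x y : cnt tau x (Jump y) (box_odometer w x) =
              cnt tau' x (Jump y) (box_odometer w x).
  have [xb|xb] := boolP (in_box x); last by rewrite /box_odometer (negbTE xb).
  by apply: cnt_ext => i im; rewrite e// ltnW.
move=> [h1 h2 h3]; split; rewrite -?ce// => x xb; rewrite -!ce (leq_trans (h1 x xb))//.
rewrite (_ : jumps tau x _ = jumps tau' x (box_odometer w x)); last first.
  by apply: eq_in_count => i; rewrite mem_iota => /andP[_ im]; rewrite e// ltnW.
rewrite /ends_asleep; case: (ltnP 0) => //= v0.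
by rewrite e// leq_pred.
Qed.

End Confinement.

(** * Windows in slots and odometers on a half-line *)

Definition jump_shift (a : int) (s : instruction) : instruction :=
  if s is Jump y then Jump (y + a) else Sleep.

Lemma jump_shiftK a : cancel (jump_shift a) (jump_shift (- a)).
Proof. by case=> //= y; rewrite addrK. Qed.

Lemma jump_shift_eqJump a s y : (jump_shift a s == Jump (y + a)) = (s == Jump y).
Proof.
apply/eqP/eqP => [|->//]; case: s => //= z [zy].
by rewrite (addIr a zy).
Qed.

Lemma jump_shift_eqSleep a s : (jump_shift a s == Sleep) = (s == Sleep).
Proof. by apply/eqP/eqP => [|->//]; case: s. Qed.

Section Windows.
Variables (o : int) (d : bool) (n : nat) (eta : int -> nat).

(** Chosen so that [box_site] numbers the box from the end facing the reference edge, in either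
    direction. *)
Definition box_end : int := if d then o else o + n%:Z.

Definition box_site (z : nat) : int := site box_end d z.

(** The box itself is slot [0] of the right side, so slot [0] of the left side is already shifted by
    [- n]. *)
Definition slot_shift (i : nat) : int :=
  if d then (i * n)%:Z else - (i.+1 * n)%:Z.

(* The instructions at the sites of the slot [i] which remain after [m z] of
   them were used at the site of index [z], moved back to the box. *)
Definition window (i : nat) (m : nat -> nat) : arrays -> arrays :=
  relabel (fun k => in_box o n k.1)
    (fun k => ((k.1 + slot_shift i)%R, (k.2 + m (site_index box_end d k.1))%N))
    (fun=> jump_shift (- slot_shift i)).

Lemma site_slot i z : site o d (i * n + z) = box_site z + slot_shift i.
Proof.
by rewrite /box_site /slot_shift /box_end /site; case: d; rewrite ?mulSn; lia.
Qed.

Lemma in_box_site z : (z < n)%N -> in_box o n (box_site z).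
Proof. by move=> zn; rewrite /in_box /box_site /box_end /site; case: d; lia. Qed.

Section Window.
Variables (i : nat) (m : nat -> nat) (tau : arrays) (z : nat).
Hypothesis zn : (z < n)%N.

Let X := site o d (i * n + z).

Lemma windowE j :
  window i m tau (box_site z) j = jump_shift (- slot_shift i) (tau X (j + m z)%N).
Proof.
by rewrite /window /relabel /= in_box_site// /box_site siteK -/(box_site z) /X site_slot.
Qed.

Lemma cnt_window y v : cnt tau X (Jump (y + slot_shift i)) (m z + v) =
  (cnt tau X (Jump (y + slot_shift i)) (m z) +
   cnt (window i m tau) (box_site z) (Jump y) v)%N.
Proof.
elim: v => [|v IH]; first by rewrite !addn0.
rewrite addnS !cntS IH addnA; congr addn; rewrite windowE (addnC v).
by rewrite -[y in RHS](addrK (slot_shift i)) jump_shift_eqJump.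
Qed.

Lemma jumps_window v : jumps tau X (m z + v) =
  (jumps tau X (m z) + jumps (window i m tau) (box_site z) v)%N.
Proof.
elim: v => [|v IH]; first by rewrite !addn0.
by rewrite addnS !jumpsS IH addnA windowE (addnC v) jump_shift_eqSleep.
Qed.

Lemma ends_asleep_window v : ends_asleep (window i m tau) (box_site z) v ->
  ends_asleep tau X (m z + v).
Proof.
case: v => [|v] //; rewrite /ends_asleep !addnS /= windowE jump_shift_eqSleep.
by rewrite (addnC v).
Qed.

End Window.

Section SideSolution.
Variables (tau : arrays) (b g : nat -> bool) (U : nat -> nat) (w : nat -> seq nat).

Definition target (y : nat) : nat := eta (box_site (y %% n)).

Definition slot_sum (s : nat -> bool) (y : nat) : nat :=
  (\sum_(z < y) s (z %/ n)%N * target z)%N.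

(** Mass balance when nobody crosses the reference edge: the mass wanted before [y], with copies in
    the slots of [s], minus the mass initially there. The truncated subtraction is exact under
    domination. *)
Definition net_flow (s : nat -> bool) (y : nat) : nat := (slot_sum s y - slot_sum b y)%N.

(** The supersolution inequality on a half-line receiving nothing across the reference edge; the
    second clause says that it sends nothing across either, so that two sides can be glued. *)
Definition side_solution (c u : nat -> nat) : Prop :=
  (forall y, (c y + (if y is y'.+1 then nfwd tau o d y' (u y') else 0)
                  + nback tau o d y.+1 (u y.+1)
     <= jumps tau (site o d y) (u y) + ends_asleep tau (site o d y) (u y))%N) /\
  nback tau o d 0 (u 0) = 0%N.

Hypothesis n0 : (0 < n)%N.
Hypothesis flU : forall Y, flow_upto tau o d (net_flow g) Y U.
Hypothesis dom : forall y, (slot_sum b y <= slot_sum g y)%N.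
Hypothesis conf : forall i, g i ->
  confined_by o n eta (window i (fun z => U (i * n + z)%N) tau) (w i).

Let i_ y := (y %/ n)%N.
Let z_ y := (y %% n)%N.
(** Two stages are superposed: [U] moves the copies of [eta] from the slots of [b] to those of [g],
    then [V] stabilizes each copy with the instructions left. [Fv] and [Bv] count the jumps of the
    second stage. *)
Let W y := window (i_ y) (fun z => U (i_ y * n + z)%N) tau.
Let V y := if g (i_ y) then box_odometer o n (w (i_ y)) (box_site (z_ y)) else 0%N.
Let u y := (U y + V y)%N.
Let Fv y := cnt (W y) (box_site (z_ y)) (Jump (fwd d (box_site (z_ y)))) (V y).
Let Bv y := cnt (W y) (box_site (z_ y)) (Jump (back d (box_site (z_ y)))) (V y).

Let yE y : y = (i_ y * n + z_ y)%N.
Proof. exact: divn_eq. Qed.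

Let zn y : (z_ y < n)%N.
Proof. by rewrite /z_ ltn_pmod. Qed.

Lemma nfwd_solution y : nfwd tau o d y (u y) = (nfwd tau o d y (U y) + Fv y)%N.
Proof.
rewrite /nfwd (_ : fwd d (site o d y) = fwd d (box_site (z_ y)) + slot_shift (i_ y)).
  have := @cnt_window (i_ y) (fun z => U (i_ y * n + z)%N) tau _ (zn y)
    (fwd d (box_site (z_ y))) (V y).
  by rewrite /= -!yE.
by rewrite {1}(yE y) site_slot /fwd; case: d; lia.
Qed.

Lemma nback_solution y : nback tau o d y (u y) = (nback tau o d y (U y) + Bv y)%N.
Proof.
rewrite /nback (_ : back d (site o d y) = back d (box_site (z_ y)) + slot_shift (i_ y)).
  have := @cnt_window (i_ y) (fun z => U (i_ y * n + z)%N) tau _ (zn y)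
    (back d (box_site (z_ y))) (V y).
  by rewrite /= -!yE.
by rewrite {1}(yE y) site_slot /back; case: d; lia.
Qed.

Let succ_same y : ((z_ y).+1 < n)%N -> i_ y.+1 = i_ y /\ z_ y.+1 = (z_ y).+1.
Proof.
move=> zS; rewrite /i_ /z_ {1 3}(yE y) -addnS divnMDl// modnMDl.
by rewrite divn_small// modn_small// addn0.
Qed.

Let succ_next y : ~~ ((z_ y).+1 < n)%N ->
  [/\ i_ y.+1 = (i_ y).+1, z_ y.+1 = 0%N & z_ y = n.-1].
Proof.
move=> zS; have zE : (z_ y).+1 = n by have := zn y; lia.
rewrite /i_ /z_ {1 3}(yE y) -addnS divnMDl// modnMDl zE divnn modnn n0 addn1.
by split=> //; rewrite -/(z_ y) -zE.
Qed.

(** Confinement forbids second-stage jumps out of a slot, here at its far end and next at its near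
    end; slots outside [g] have no second stage. *)
Let Fv_last y : z_ y = n.-1 -> Fv y = 0%N.
Proof.
rewrite /Fv /V => ->; case: ifP => // /conf[_ left right].
have [lastE fwdE] : box_site n.-1 = (if d then o + n%:Z - 1 else o) /\
    fwd d (box_site n.-1) = (if d then o + n%:Z else o - 1).
  by rewrite /box_site /box_end /site /fwd; case: d; split; lia.
by rewrite fwdE lastE; case: d {lastE fwdE} left right.
Qed.

Let Bv_first y : z_ y = 0%N -> Bv y = 0%N.
Proof.
rewrite /Bv /V => ->; case: ifP => // /conf[_ left right].
have [firstE backE] : box_site 0 = (if d then o else o + n%:Z - 1) /\
    back d (box_site 0) = (if d then o - 1 else o + n%:Z).
  by rewrite /box_site /box_end /site /back; case: d; split; lia.
by rewrite backE firstE; case: d {firstE backE} left right.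
Qed.

(* Nothing leaves a window, so only neighbours in the same slot interact. *)
Lemma window_inequality y :
  (g (i_ y) * target y + (if y is y'.+1 then Fv y' else 0) + Bv y.+1
   <= jumps (W y) (box_site (z_ y)) (V y) + ends_asleep (W y) (box_site (z_ y)) (V y))%N.
Proof.
pose x := box_site (z_ y).
have inF : ((if y is y'.+1 then Fv y' else 0) <= g (i_ y) *
    cnt (W y) (back d x) (Jump x) (box_odometer o n (w (i_ y)) (back d x)))%N.
  case: y @x => [|y] x //.
  have [/succ_same[iS zS]|/succ_next[iS zS zE]] := boolP ((z_ y).+1 < n)%N; last first.
    by rewrite Fv_last.
  have -> : back d x = box_site (z_ y) by rewrite /x zS /box_site back_site.
  have fE : fwd d (box_site (z_ y)) = box_site (z_ y).+1 by rewrite /box_site fwd_site.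
  by rewrite /x zS /Fv /W /V iS fE; case: (g _) => //; rewrite mul1n.
have inB : (Bv y.+1 <= g (i_ y) *
    cnt (W y) (fwd d x) (Jump x) (box_odometer o n (w (i_ y)) (fwd d x)))%N.
  have [/succ_same[iS zS]|/succ_next[iS zS zE]] := boolP ((z_ y).+1 < n)%N; last first.
    by rewrite Bv_first.
  have -> : fwd d x = box_site (z_ y.+1) by rewrite /x zS /box_site fwd_site.
  have bE : back d (box_site (z_ y).+1) = x by rewrite /box_site back_site.
  by rewrite /Bv /W /V iS zS bE; case: (g _) => //; rewrite mul1n.
apply: (leq_trans (leq_add (leq_add (leqnn _) inF) inB)).
rewrite -!mulnDr /V; case: ifP => // gi; rewrite mul1n.
exact: (confined_neighbours d (conf gi) (in_box_site (zn y))).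
Qed.

(** The flow [U] turns the initial mass [b * target] at each site into [g * target], and
    [window_inequality] handles the latter. *)
Lemma good_side_solution : side_solution (fun y => b (i_ y) * target y)%N u.
Proof.
split=> [y|]; last first.
  (* The prescribed net flow across the reference edge is an empty sum, hence zero. *)
  rewrite nback_solution Bv_first /z_ ?mod0n// addn0.
  have [-> _] := @flU 1 0 isT.
  by rewrite /= /net_flow /slot_sum !big_ord0.
have [Ey _] := @flU y.+1 y (ltnSn y).
have [Ey1 _] := @flU y.+2 y.+1 (ltnSn y.+1).
(* Conservation at [y]; [dom] makes both truncated differences exact. *)
have flowS : (b (i_ y) * target y + net_flow g y.+1 = net_flow g y + g (i_ y) * target y)%N.
  have := dom y; have := dom y.+1; rewrite /net_flow /slot_sum !big_ord_recr /=.
  by rewrite -/(i_ y); lia.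
rewrite nback_solution Ey1 /=.
have -> : jumps tau (site o d y) (u y) =
    (jumps tau (site o d y) (U y) + jumps (W y) (box_site (z_ y)) (V y))%N.
  have := @jumps_window (i_ y) (fun z => U (i_ y * n + z)%N) tau _ (zn y) (V y).
  by rewrite /= -!yE.
have sl : (ends_asleep (W y) (box_site (z_ y)) (V y) <= ends_asleep tau (site o d y) (u y))%N.
  case e : (ends_asleep (W y) _ _) => //.
  by have := ends_asleep_window (zn y) e; rewrite /= -!yE => ->.
have := window_inequality y.
have := cnt_jumps tau (site o d y) (U y) (@back_neq_fwd d (site o d y)).
rewrite -/(nback tau o d y (U y)) -/(nfwd tau o d y (U y)) Ey.
have : ((if y is y'.+1 then nfwd tau o d y' (u y') else 0) + net_flow g y =
    back_needed tau o d (net_flow g) U y + (if y is y'.+1 then Fv y' else 0))%N.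
  case: (y) => [|y'] /=; last by rewrite nfwd_solution; lia.
  by rewrite addn0.
lia.
Qed.

End SideSolution.
End Windows.

(** Since neither side jumps across the reference edge, the two odometers together form a
    supersolution on the whole line, whose value at the origin bounds the odometer by least
    action. *)
Lemma side_solutions_fixate (R : realType) (tau : arrays) o (c : int -> nat)
    (u : bool -> nat -> nat) : nearest_jumps tau ->
  (forall d, side_solution o d tau (fun y => c (site o d y)) (u d)) ->
  fixates tau R (all_active c).
Proof.
move=> nn sol.
pose v x := if on_side o true x then u true (site_index o true x)
            else u false (site_index o false x).
have vE d y : v (site o d y) = u d y.
  rewrite /v; have := on_side_site o d y; case: d => [->|].
    by rewrite siteK.
  by rewrite (on_sideN o true) => /negbTE->; rewrite siteK.
have sup x : setT x -> supersolution tau c v x.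
  move=> _; pose d := on_side o true x.
  have xd : on_side o d x.
    by rewrite /d; case e : (on_side o true x) => //; rewrite (on_sideN o true) e.
  rewrite -(site_indexK xd); move: (site_index o d x) => y {xd}.
  apply: (neighbours_supersolution (d := d)) => //.
  have [ineq back0] := sol d; rewrite vE (leq_trans _ (ineq y))//.
  have [_ oback0] := sol (~~ d).
  rewrite {ineq} fwd_site vE /nback back_site leq_add2r leq_add2l.
  case: y => [|y]; last by rewrite back_site vE /nfwd fwd_site.
  rewrite back_site0 vE.
  rewrite (_ : site o d 0 = back (~~ d) (site o (~~ d) 0)); last first.
    by rewrite back_site0 negbK.
  by move: oback0; rewrite /nback => ->.
rewrite /fixates (@le_lt_trans _ _ ((v 0)%:R%:E)) ?ltry//.
apply: ge_ereal_sup => _ [alpha leg <-]; rewrite lee_fin ler_nat.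
exact: (least_action sup leg (fun _ _ => Logic.I)).
Qed.

(** When all jumps point away from the reference edge, it suffices that each site pushes forward
    everything initially at or before it: nothing ever returns. *)
Lemma escape_side_solution tau o d (c : nat -> nat) :
  (forall y i, tau (site o d y) i <> Jump (back d (site o d y))) ->
  (forall y N, exists m, (N <= nfwd tau o d y m)%N) ->
  exists u, side_solution o d tau c u.
Proof.
move=> noback often.
have hit y N : exists m, nfwd tau o d y m = N.
  elim: N => [|N [m IH]]; first by exists 0%N.
  have [m' m'N m'min] := ex_minnP (often y N.+1).
  exists m'; apply/eqP; rewrite eqn_leq m'N andbT.
  case: m' m'N m'min => // m' m'N m'min.
  have : ~~ (N.+1 <= nfwd tau o d y m')%N by apply/negP => /m'min; rewrite ltnn.
  by rewrite /nfwd cntS; case: eqP => _; lia.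
pose u y := xget 0%N [set m | nfwd tau o d y m = \sum_(z < y.+1) c z]%N.
have uE y : nfwd tau o d y (u y) = (\sum_(z < y.+1) c z)%N.
  have [m mE] := hit y (\sum_(z < y.+1) c z)%N.
  exact: (@xgetPex _ 0%N [set m | nfwd tau o d y m = \sum_(z < y.+1) c z]%N (ex_intro _ m mE)).
have back0 y m : nback tau o d y m = 0%N.
  rewrite /nback /cnt; apply/eqP; rewrite -leqn0 leqNgt -has_count; apply/hasPn => i _.
  by apply/eqP; exact: noback.
exists u; split=> // y; rewrite back0 addn0 (leq_trans _ (leq_addr _ _))//.
apply: leq_trans (cnt_jumps tau (site o d y) (u y) (@back_neq_fwd d (site o d y))).
rewrite (leq_trans _ (leq_addl _ _))//.
rewrite -/(nfwd tau o d y (u y)) uE.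
case: y => [|y]; first by rewrite big_ord_recr big_ord0 /= addn0.
by rewrite uE [leqRHS]big_ord_recr /= addnC.
Qed.

(** * Good slots *)

Lemma supported_sub (K K' : pred key) A : (forall z, K z -> K' z) ->
  supported K A -> supported K' A.
Proof. by move=> KK' sA tau tau' e; apply: sA => z /KK'; exact: e. Qed.

Lemma supportedI K A B : supported K A -> supported K B -> supported K (A `&` B).
Proof. by move=> sA sB tau tau' e [/(sA _ _ e) ? /(sB _ _ e)]. Qed.

Lemma supportedC K A : supported K A -> supported K (~` A).
Proof. by move=> sA tau tau' e nA At'; apply: nA; apply: sA At' => z /e. Qed.

(** Law of total probability: if [G t] has conditional probability [r] on each of the disjoint
    events [F t], it has it on their union. *)
Lemma mixture (R : realType) (Q : probability arrays R) (T : countType)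
    (F G : T -> set arrays) (r : \bar R) : r \is a fin_num ->
  (forall t, measurable (F t)) -> (forall t, measurable (G t)) ->
  (forall t t' tau, F t tau -> F t' tau -> t = t') ->
  (forall t, Q (F t `&` G t) = (r * Q (F t))%E) ->
  Q (\bigcup_t (F t `&` G t)) = (r * Q (\bigcup_t F t))%E.
Proof.
move=> rfin mF mG disj FG.
(* The family is enumerated by codes, with the empty set at numbers that code nothing. *)
pose en (A : T -> set arrays) k :=
  if (pickle_inv k : option T) is Some t then A t else set0.
have enE A : \bigcup_t A t = \bigcup_k en A k.
  apply/seteqP; split=> tau [t _ At]; first by exists (pickle t) => //; rewrite /en pickleK_inv.
  by move: At; rewrite /en; case: (pickle_inv t) => // u Au; exists u.
have men A : (forall t, measurable (A t)) -> forall k, measurable (en A k).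
  by move=> mA k; rewrite /en; case: (pickle_inv k).
have triv A : (forall t t' tau, A t tau -> A t' tau -> t = t') -> trivIset setT (en A).
  move=> disjA; apply/trivIsetP => i j _ _ /eqP ij; rewrite -subset0 => tau [].
  rewrite /en; case ei : (pickle_inv i) => [t|//]; case ej : (pickle_inv j) => [t'|//].
  move=> At At'; apply: ij; have tt := disjA _ _ _ At At'; subst t'.
  by have := @pickle_invK T i; have := @pickle_invK T j; rewrite /ocancel ei ej /= => -> ->.
rewrite !enE !measure_bigcup//; last 4 first.
- by move=> k _; exact: men.
- exact: triv.
- by move=> k _; apply: men => t; exact: measurableI.
- by apply: triv => t t' tau [Ft _] [Ft' _]; exact: disj Ft Ft'.
rewrite -(fineK rfin) -nneseriesZl; last by move=> k _; exact: measure_ge0.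
apply: eq_eseriesr => k _; rewrite fineK// /en; case: (pickle_inv k) => [t|].
  exact: FG.
by rewrite !measure0 mule0.
Qed.

Section Patterns.
Context {R : realType} (lambda : R) (p : int -> int -> R).
Variable Q : probability arrays R.
Hypotheses (lawQ : array_law lambda p Q) (p_ti : translation_invariant p).
Variables (o : int) (d : bool) (n : nat) (eta : int -> nat) (b : nat -> bool).
Hypothesis n0 : (0 < n)%N.

Let confined_prob := Q (confined o n eta).

(** Translation invariance gives instructions moved back from a slot the law of those of the box;
    the offsets [m] only change which coordinates are read. *)
Lemma window_law i m : Q (window o d n i m @^-1` confined o n eta) = confined_prob.
Proof.
apply: (relabel_law lawQ (g := fun=> jump_shift (slot_shift d n i))).
- exact: measurable_confined.
- exact: confined_supported.
- move=> [x j] [x' j'] /= _ _ [xx jj].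
  have xE : x = x' by lia.
  by rewrite xE in jj *; congr pair; lia.
- by move=> z; rewrite -{2}(opprK (slot_shift d n i)); exact: jump_shiftK.
- by move=> z; exact: jump_shiftK.
- move=> [x j] [|y] _ //=; congr (_ / _); apply: p_ti; lia.
Qed.

Definition slot_key (i : nat) (k : key) : bool :=
  on_side o d k.1 && (i * n <= site_index o d k.1 < i.+1 * n)%N.

Definition before_slot (i : nat) (k : key) : bool :=
  on_side o d k.1 && (site_index o d k.1 < i * n)%N.

(** Flows are recorded as lists, so that conditioning on the flow is a countable sum. *)
Definition slot_flow (s : seq bool) (i : nat) (U : seq nat) : set arrays :=
  [set tau | size U = (i.+1 * n)%N /\
     flow_upto tau o d (net_flow o d n eta b (nth false s)) (i.+1 * n) (nth 0%N U)].

Definition slot_confined (i : nat) (U : seq nat) : set arrays :=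
  window o d n i (fun z => nth 0%N U (i * n + z)) @^-1` confined o n eta.

Definition good_slot (s : seq bool) (i : nat) : set arrays :=
  \bigcup_U (slot_flow (rcons s true) i U `&` slot_confined i U).

Definition used_key (i : nat) (U : seq nat) (k : key) : bool :=
  [&& on_side o d k.1, (site_index o d k.1 < i.+1 * n)%N &
      (k.2 < nth 0 U (site_index o d k.1))%N].

(** Stopping property: both the required counts and minimality are checked on instructions of index
    below [U]. *)
Lemma slot_flow_used s i U : supported (used_key i U) (slot_flow s i U).
Proof.
move=> tau tau' e [sU fl]; split=> //.
have ek y j : (y < i.+1 * n)%N -> (j < nth 0 U y)%N ->
    tau (site o d y) j = tau' (site o d y) j.
  move=> yi jU; apply: (e (site o d y, j)).
  by rewrite /used_key /= on_side_site siteK yi jU.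
have eb y m : (y < i.+1 * n)%N -> (m <= nth 0 U y)%N ->
    nback tau o d y m = nback tau' o d y m.
  by move=> yi mU; apply: cnt_ext => j jm; rewrite ek// (leq_trans jm).
have ef y m : (y < i.+1 * n)%N -> (m <= nth 0 U y)%N ->
    nfwd tau o d y m = nfwd tau' o d y m.
  by move=> yi mU; apply: cnt_ext => j jm; rewrite ek// (leq_trans jm).
move=> y yi; have [h1 h2] := fl y yi.
set D := net_flow _ _ _ _ _ _ in h1 h2 *.
have en : back_needed tau o d D (nth 0%N U) y = back_needed tau' o d D (nth 0%N U) y.
  by case: (y) yi => [//|y'] yi /=; rewrite ef// (ltn_trans _ yi).
split; first by rewrite -eb// -en.
by move=> m mU; rewrite -eb ?(ltnW mU)// -en; exact: h2.
Qed.

Lemma measurable_slot_flow s i U : measurable (slot_flow s i U).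
Proof.
apply: (@measurable_supported_seq
  [seq (site o d y, j) | y <- iota 0 (i.+1 * n), j <- iota 0 (\max_(k <- U) k)]).
apply: supported_sub (@slot_flow_used s i U) => -[x j] /and3P[/= xs xi jU].
apply/allpairsP; exists (site_index o d x, j); split; rewrite ?mem_iota//=.
  have [kU|kU] := ltnP (site_index o d x) (size U); last by rewrite nth_default in jU.
  rewrite (leq_trans jU)//; apply: (@leq_bigmax_seq _ _ xpredT id) => //; exact: mem_nth.
by rewrite site_indexK.
Qed.

Lemma measurable_slot_confined i U : measurable (slot_confined i U).
Proof.
apply: measurable_preimageT; first exact: measurable_relabelling.
exact: measurable_confined.
Qed.

Lemma measurable_good_slot s i : measurable (good_slot s i).
Proof.
apply: countable_bigcupT_measurable => // U.
by apply: measurableI; [exact: measurable_slot_flow|exact: measurable_slot_confined].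
Qed.

Lemma slot_confined_fresh i U :
  supported (fun k => slot_key i k && ~~ used_key i U k) (slot_confined i U).
Proof.
move=> tau tau' e; rewrite /slot_confined /=.
rewrite (_ : window o d n i _ tau = window o d n i (fun z => nth 0%N U (i * n + z)) tau')//.
apply/funext => x; apply/funext => j; rewrite /window /relabel /=.
case: ifPn => // xb; congr jump_shift.
set y := site_index (box_end o d n) d x.
have yn : (y < n)%N.
  by rewrite /y /site_index /box_end; move: xb; rewrite /in_box; case: d; lia.
have xE : x + slot_shift d n i = site o d (i * n + y).
  rewrite site_slot /box_site site_indexK//.
  by rewrite /on_side /box_end; move: xb; rewrite /in_box; case: d; lia.
apply: (e (x + slot_shift d n i, (j + nth 0 U (i * n + y))%N)).
rewrite xE /slot_key /used_key /= on_side_site siteK /= leq_addr mulSn.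
by rewrite [(_ * _ + _)%N]addnC ltn_add2r yn /= -leqNgt leq_addl.
Qed.

Lemma slot_key_before i k : slot_key i k -> ~~ before_slot i k.
Proof.
by rewrite /slot_key /before_slot => /and3P[-> ik _] /=; rewrite -leqNgt.
Qed.

Lemma good_slot_supported s i : supported (before_slot i.+1) (good_slot s i).
Proof.
move=> tau tau' e [U _ [fl cf]]; exists U => //; split.
  apply: slot_flow_used fl => k /and3P[ks ki _].
  by apply: e; rewrite /before_slot ks.
apply: slot_confined_fresh cf => k /andP[/and3P[ks _ ki] _].
by apply: e; rewrite /before_slot ks.
Qed.

Hypothesis often_back : forall y,
  sure Q [set tau : arrays | forall N, exists m, (N <= nback tau o d y m)%N].

Lemma good_slot_indep (H : set arrays) s i : measurable H ->
  supported (predC (slot_key i)) H ->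
  Q (H `&` good_slot s i) = (confined_prob * Q H)%E.
Proof.
move=> mH sH.
have mFl := measurable_slot_flow (rcons s true) i.
have mCf := measurable_slot_confined i.
have -> : H `&` good_slot s i =
    \bigcup_U ((H `&` slot_flow (rcons s true) i U) `&` slot_confined i U).
  by rewrite /good_slot setI_bigcupr; apply: eq_bigcupr => U _; rewrite setIA.
rewrite (@mixture R Q _ _ _ confined_prob) //.
- congr (_ * _)%E; rewrite -setI_bigcupr.
  (* Back jumps almost surely never run out, so some flow exists: the events [slot_flow] cover [H]
     up to a null set. *)
  apply/eqP; rewrite eq_le; apply/andP; split.
    apply: le_measure; rewrite ?inE//.
    by apply: measurableI => //; exact: countable_bigcupT_measurable.
  apply: (sure_le (sure_bigcap often_back)) => //.
    by apply: measurableI => //; exact: countable_bigcupT_measurable.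
  move=> tau [Ht often]; split=> //.
  have [U flU] := flow_exists (net_flow o d n eta b (nth false (rcons s true)))
    (fun y => often y Logic.I).
  exists (mkseq U (i.+1 * n)) => //; split; first by rewrite size_mkseq.
  move=> y yi; have [h1 h2] := flU _ y yi.
  set D := net_flow _ _ _ _ _ _ in h1 h2 *.
  have -> : back_needed tau o d D (nth 0%N (mkseq U (i.+1 * n))) y =
            back_needed tau o d D U y.
    by case: (y) yi => [//|y'] yi /=; rewrite nth_mkseq// (ltn_trans _ yi).
  by rewrite nth_mkseq.
- exact: fin_num_measure _ _ (measurable_confined o n eta).
- by move=> U; exact: measurableI.
(* Uniqueness of the flow makes the events over [U] disjoint. *)
- move=> U U' tau [_ [sU flU]] [_ [sU' flU']].
  apply: (@eq_from_nth _ 0%N); first by rewrite sU sU'.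
  by move=> y; rewrite sU => yi; exact: (flow_unique _ flU flU').
- move=> U; rewrite setIC.
  rewrite (indep_supported lawQ (K := fun k => slot_key i k && ~~ used_key i U k)) //.
  + by rewrite /slot_confined window_law.
  + exact: measurableI.
  + exact: slot_confined_fresh.
  + apply: supportedI.
      by apply: supported_sub sH => k /=; apply: contra => /andP[].
    apply: supported_sub (@slot_flow_used _ i U) => k /= uk.
    by rewrite uk andbF.
Qed.

(* The slot [i] is tested with the flow which brings a copy of [eta] into it;
   when the test fails, it is left empty in the flow used further on. *)
Fixpoint pattern (i : nat) (tau : arrays) : seq bool :=
  if i is i'.+1 then
    rcons (pattern i' tau) `[< good_slot (pattern i' tau) i' tau >]
  else [::].

Lemma size_pattern i tau : size (pattern i tau) = i.
Proof. by elim: i => //= i IH; rewrite size_rcons IH. Qed.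

Lemma pattern_rcons i s x : [set tau | pattern i.+1 tau = rcons s x] =
  [set tau | pattern i tau = s] `&` (if x then good_slot s i else ~` good_slot s i).
Proof.
apply/seteqP; split=> tau /=.
  move=> /rcons_inj[<- <-]; split=> //.
  by case: ifPn => /asboolP.
move=> [-> gs]; congr rcons.
by case: x gs => gs; [exact: asboolT|exact: asboolF].
Qed.

Lemma measurable_pattern i s : measurable [set tau | pattern i tau = s].
Proof.
elim: i s => [|i IH] s.
  apply: (@measurable_supported_seq [::]) => tau tau' _ //.
case/lastP: s => [|s x].
  rewrite (_ : [set _ | _] = set0)// -subset0 => tau /=.
  by case: (pattern i tau).
rewrite pattern_rcons; apply: measurableI => //; have mg := measurable_good_slot s i.
by case: x => //; exact: measurableC.
Qed.

Lemma pattern_supported i s : supported (before_slot i) [set tau | pattern i tau = s].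
Proof.
elim: i s => [|i IH] s //.
case/lastP: s => [|s x].
  by move=> tau tau' _ /=; case: (pattern i tau).
rewrite pattern_rcons; apply: supportedI.
  apply: supported_sub (IH s) => k /andP[ks ki]; rewrite /before_slot ks.
  by rewrite mulSn (leq_trans ki)// leq_addl.
by case: x; [|apply: supportedC]; exact: good_slot_supported.
Qed.

Definition weight (s : seq bool) : \bar R :=
  (\prod_(x <- s) (if x then confined_prob else 1 - confined_prob))%E.

(** The earlier pattern is read strictly before slot [size s], so the next test is independent of
    it; a failed test is handled by subtraction. *)
Lemma pattern_law s : Q [set tau | pattern (size s) tau = s] = weight s.
Proof.
elim/last_ind: s => [|s x IH].
  rewrite /weight big_nil -(probability_setT Q); congr (Q _).
  by apply/seteqP; split.
rewrite size_rcons pattern_rcons /weight -cats1 big_cat big_seq1 -/(weight s).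
rewrite -[RHS]/(weight s * (if x then confined_prob else 1 - confined_prob))%E.
have mP := measurable_pattern (size s) s.
have sP : supported (predC (slot_key (size s))) [set tau | pattern (size s) tau = s].
  apply: supported_sub (@pattern_supported (size s) s) => k /=.
  by apply: contraL; exact: slot_key_before.
have indep := good_slot_indep s mP sP.
rewrite IH in indep; case: x; first by rewrite muleC -indep.
have mg := measurable_good_slot s (size s).
have wfin : weight s \is a fin_num by rewrite -IH; exact: fin_num_measure.
have cfin : confined_prob \is a fin_num.
  exact: fin_num_measure _ _ (measurable_confined o n eta).
have : weight s = (Q ([set tau | pattern (size s) tau = s] `&` ~` good_slot s (size s))
    + confined_prob * weight s)%E by rewrite -indep -{1}IH -setDE; exact: measureDI.
have Xfin : Q ([set tau | pattern (size s) tau = s] `&` ~` good_slot s (size s))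
    \is a fin_num.
  by apply: fin_num_measure; apply: measurableI => //; exact: measurableC.
rewrite -(fineK Xfin) -(fineK wfin) -(fineK cfin) -!(EFinM, EFinB, EFinD).
by move=> [h]; congr EFin; rewrite mulrBr mulr1 [X in X - _]h mulrC addrK.
Qed.

End Patterns.

(** * Good slots dominate occupied slots forever with positive probability *)

Section Survival.
Context {R : realType} (lambda : R) (p : int -> int -> R).
Variable Q : probability arrays R.
Hypotheses (lawQ : array_law lambda p Q) (p_ti : translation_invariant p).
Variables (o : int) (d : bool) (n : nat) (eta : int -> nat) (b : nat -> bool).
Hypothesis n0 : (0 < n)%N.
Hypothesis often_back : forall y,
  sure Q [set tau : arrays | forall N, exists m, (N <= nback tau o d y m)%N].
Variables (r M : nat).
Let c : R := fine (Q (confined o n eta)).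
Hypothesis rM : r%:R < c * M%:R.
Hypothesis b_density : forall i, (M * \sum_(j < i) b j <= r * i + r * M)%N.

Definition dominated (s : seq bool) : Prop :=
  forall j, (j <= size s)%N -> (\sum_(j' < j) b j' <= count id (take j s))%N.

Let pat i tau := pattern o d n eta b i tau.

Let cE : c%:E = Q (confined o n eta).
Proof. by rewrite fineK// fin_num_measure//; exact: measurable_confined. Qed.

Let c_ge0 : 0 <= c.
Proof. by rewrite -lee_fin cE. Qed.

Let c_le1 : c <= 1.
Proof. by rewrite -lee_fin cE probability_le1//; exact: measurable_confined. Qed.

Let c_gt0 : 0 < c.
Proof.
rewrite lt_def c_ge0 andbT; apply/eqP => c0; move: rM.
by rewrite c0 mul0r ltNge ler0n.
Qed.

Let rltM : (r < M)%N.
Proof.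
by rewrite -(ltr_nat R) (lt_le_trans rM)// ler_piMl.
Qed.

Let wt (s : seq bool) : R := \prod_(x <- s) (if x then c else 1 - c).

Let wt_rcons s x : wt (rcons s x) = wt s * (if x then c else 1 - c).
Proof. by rewrite /wt -cats1 big_cat big_seq1. Qed.

Let wt_ge0 s : 0 <= wt s.
Proof. by apply: prodr_ge0 => -[] _; rewrite ?subr_ge0. Qed.

Let pattern_wt s : Q [set tau | pat (size s) tau = s] = (wt s)%:E.
Proof.
rewrite (pattern_law lawQ p_ti eta b n0 often_back) /weight /wt -prodEFin.
by apply: eq_bigr => -[] _; rewrite -?cE.
Qed.

(** The two sides agree at [t = 1], where their derivatives are [c * M > r], so the inequality holds
    slightly below [1]. The bounds [upper] and [lower] of Bernoulli type make this quantitative. *)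
Lemma exists_contraction : exists t : R, [/\ 0 < t, t < 1 & 1 - c + c * t ^+ M <= t ^+ r].
Proof.
have M0 : 0 < M%:R :> R by rewrite ltr0n (leq_ltn_trans _ rltM).
pose rho : R := r%:R / (c * M%:R).
have cM0 : 0 < c * M%:R by exact: mulr_gt0.
have rho1 : rho < 1 by rewrite /rho ltr_pdivrMr// mul1r.
have rho0 : 0 <= rho by rewrite divr_ge0// ltW.
(* This size gives [(1 - eps) ^+ M >= rho], so that [c * (1 - a)] is at least [r * eps], which
   bounds [1 - e]. *)
pose eps : R := (1 - rho) / (2 * M%:R).
have eps0 : 0 < eps by rewrite divr_gt0 ?subr_gt0// mulr_gt0.
have Meps : M%:R * eps = (1 - rho) / 2 by rewrite /eps invfM mulrCA [_^-1 * _]mulrC mulVKf ?gt_eqF.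
have M1 : 1 <= M%:R :> R by rewrite ler1n (leq_ltn_trans _ rltM).
have eps1 : eps < 1 by nra.
have upper k : 1 - k%:R * eps <= (1 - eps) ^+ k.
  elim: k => [|k IH]; first by rewrite mul0r subr0.
  have k0 : 0 <= k%:R :> R by exact: ler0n.
  by rewrite exprS -natr1; nra.
have lower k : k%:R * eps * (1 - eps) ^+ k <= 1 - (1 - eps) ^+ k.
  elim: k => [|k IH]; first by rewrite !mul0r expr0 subrr.
  have p0 : 0 <= (1 - eps) ^+ k by apply: exprn_ge0; lra.
  have k0 : 0 <= k%:R * eps * (1 - eps) ^+ k.
    by apply: mulr_ge0 => //; apply: mulr_ge0 => //; exact: ltW.
  by rewrite exprS -natr1; nra.
exists (1 - eps); split; [lra|lra|].
have := upper r; have := upper M; have := lower M; rewrite Meps.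
set a := (1 - eps) ^+ M; set e := (1 - eps) ^+ r => h1 h2 h3.
have ar : rho <= a by lra.
have rE : r%:R = rho * (c * M%:R) by rewrite /rho divfK// gt_eqF.
rewrite rE in h3.
have h4 : c * (M%:R * eps) * rho <= c * (1 - a).
  rewrite -mulrA ler_wpM2l//; apply: le_trans h1; rewrite Meps ler_wpM2l//; lra.
by move: h4 h3; rewrite mulrBr; lra.
Qed.

Lemma take_pattern i k tau : take i (pat (i + k) tau) = pat i tau.
Proof.
elim: k => [|k IH]; first by rewrite addn0 take_oversize// size_pattern.
by rewrite addnS /= -cats1 take_cat size_pattern ltn_neqAle leq_addr andbT;
  case: eqP => [e|_ //]; rewrite -e subnn cats0 e.
Qed.

Lemma dominated_pattern_le i k tau : dominated (pat (i + k) tau) -> dominated (pat i tau).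
Proof.
move=> dom j; rewrite size_pattern => ji.
have := dom j; rewrite size_pattern (leq_trans ji (leq_addr _ _)) => /(_ isT).
by rewrite -(take_pattern i k) take_takel.
Qed.

Lemma measurable_dominated i : measurable [set tau | dominated (pat i tau)].
Proof.
rewrite (_ : [set _ | _] =
    \bigcup_s [set tau | pat i tau = s /\ dominated s]); last first.
  by apply/seteqP; split=> [tau ok|tau [s _ [<-]]]//; exists (pat i tau).
apply: countable_bigcupT_measurable => // s.
have [ok|nok] := pselect (dominated s).
  rewrite (_ : [set _ | _] = [set tau | pat i tau = s]); first exact: measurable_pattern.
  by apply/seteqP; split=> [tau []|].
by rewrite (_ : [set _ | _] = set0)// -subset0 => tau [].
Qed.

Lemma dominated_rcons s x : dominated s ->
  (\sum_(j < (size s).+1) b j <= count id (rcons s x))%N -> dominated (rcons s x).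
Proof.
move=> ok last j; rewrite size_rcons leq_eqVlt => /predU1P[->|].
  by rewrite take_oversize// size_rcons.
rewrite ltnS => js; rewrite -cats1 takel_cat//; exact: ok.
Qed.

(* The potential [t ^+ (M * #good) / t ^+ (r * #slots)] is a supermartingale. *)
Lemma dominated_ge t s k : 0 < t -> t < 1 -> 1 - c + c * t ^+ M <= t ^+ r ->
  dominated s ->
  wt s * (1 - t ^+ (M * count id s) / t ^+ (r * size s + r * M)) <=
  fine (Q [set tau | pat (size s) tau = s /\ dominated (pat (size s + k) tau)]).
Proof.
move=> t0 t1 tc.
(* The extra exponent [r * M] absorbs the additive slack in [b_density]. *)
pose psi s := t ^+ (M * count id s) / t ^+ (r * size s + r * M).
have psi0 s' : 0 <= psi s' by rewrite divr_ge0 ?exprn_ge0// ltW.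
pose X s k := [set tau | pat (size s) tau = s /\ dominated (pat (size s + k) tau)].
have mX s' k' : measurable (X s' k').
  by apply: measurableI; [exact: measurable_pattern|exact: measurable_dominated].
have Xfin s' k' : Q (X s' k') \is a fin_num by exact: fin_num_measure.
rewrite -/(psi s) -/(X s k).
elim: k s => [|k IH] s ok.
  rewrite (_ : X s 0%N = [set tau | pat (size s) tau = s]); last first.
    by apply/seteqP; split=> [tau []|tau /= e]//; rewrite /X /= addn0 e.
  rewrite pattern_wt /= ler_piMr// gerBl//; exact: psi0.
have branch x : wt (rcons s x) * (1 - psi (rcons s x)) <= fine (Q (X (rcons s x) k)).
  have [last|last] := leqP (\sum_(j < (size s).+1) b j) (count id (rcons s x)).
    by apply: IH; exact: dominated_rcons.
  (* If domination breaks at this slot, the density bound forces the potential to be at least [1],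
     and the claimed lower bound is not positive. *)
  rewrite (@le_trans _ _ 0)// ?fine_ge0// mulr_ge0_le0// subr_le0 /psi.
  rewrite ler_pdivlMr ?exprn_gt0// mul1r ler_wiXn2l//; [exact: ltW|exact: ltW|].
  have := b_density (size s).+1; rewrite size_rcons.
  by apply: leq_trans; rewrite leq_mul2l ltnW ?orbT.
have split : X (rcons s true) k `|` X (rcons s false) k `<=` X s k.+1.
  move=> tau; have h x : X (rcons s x) k tau -> X s k.+1 tau.
    rewrite /X /= size_rcons addnS -addSn => -[/rcons_inj[e _] dom].
    by split.
  by case; exact: h.
have disj : X (rcons s true) k `&` X (rcons s false) k = set0.
  rewrite -subset0 => tau [[+ _] [+ _]]; rewrite !size_rcons => ->.
  by move=> /rcons_inj[].
have le : fine (Q (X (rcons s true) k)) + fine (Q (X (rcons s false) k)) <=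
          fine (Q (X s k.+1)).
  rewrite -lee_fin EFinD !fineK// -measureU//.
  by apply: le_measure; rewrite ?inE//; exact: measurableU.
apply: le_trans le; apply: le_trans (lerD (branch true) (branch false)).
have psi_true : psi (rcons s true) = psi s * (t ^+ M / t ^+ r).
  rewrite /psi -cats1 count_cat size_cat /= addn0 !addn1 !mulnSr.
  by rewrite [(_ + r + _)%N]addnAC !(exprD _ (_ + _)) !(exprD _ (M * _)) invfM mulrACA.
have psi_false : psi (rcons s false) = psi s / t ^+ r.
  rewrite /psi -cats1 count_cat size_cat /= !addn0 addn1 mulnSr.
  by rewrite [(_ + r + _)%N]addnAC (exprD _ (_ + _)) invfM mulrA.
rewrite !wt_rcons psi_true psi_false -!(mulrA (wt s)) -mulrDr ler_wpM2l//.
have tr0 : 0 < t ^+ r by exact: exprn_gt0.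
(* The mean of the potential over the two outcomes does not increase, by the choice of [t]. *)
have : psi s * ((1 - c + c * t ^+ M) / t ^+ r) <= psi s.
  by rewrite ler_piMr// ler_pdivrMr// mul1r.
rewrite mulrDl mulrDr mulrCA -(mulrA c) (mulrCA (psi s) c).
by move: (psi s / t ^+ r) (psi s * (t ^+ M / t ^+ r)) (psi s) => y z x; lra.
Qed.

Lemma survival : (0 < Q [set tau | forall i, dominated (pat i tau)])%E.
Proof.
have [t [t0 t1 tc]] := exists_contraction.
(* Starting with this many good slots gives [M * m > r * m + r * M], since [r < M], so the initial
   potential is below [1]. *)
pose m := (r * M).+1.
pose s0 := nseq m true.
have size_s0 : size s0 = m by rewrite size_nseq.
have count_s0 : count id s0 = m by rewrite count_nseq mul1n.
have ok0 : dominated s0.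
  move=> j; rewrite size_s0 => jm; rewrite take_nseq// count_nseq mul1n.
  by rewrite -[leqRHS]card_ord -sum1_card; apply: leq_sum => i _; exact: leq_b1.
pose delta := wt s0 * (1 - t ^+ (M * m) / t ^+ (r * m + r * M)).
have delta0 : 0 < delta.
  rewrite mulr_gt0//.
    by rewrite /wt /s0 big_nseq iter_mulr_1 exprn_gt0.
  rewrite subr_gt0 ltr_pdivrMr ?exprn_gt0// mul1r ltr_iXn2l//.
  by have := leq_mul rltM (leqnn m); rewrite mulSn addnC; apply: leq_trans; rewrite ltn_add2l.
pose F i := [set tau | dominated (pat i tau)].
have mF i : measurable (F i) by exact: measurable_dominated.
have mFI : measurable (\bigcap_i F i) by exact: bigcapT_measurable.
have Fdec : nonincreasing_seq F.
  move=> i j ij; apply/subsetPset => tau; rewrite /F /= -(subnKC ij).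
  exact: dominated_pattern_le.
have Fge i : (delta%:E <= Q (F i))%E.
  have le : (delta%:E <= Q (F (m + i)%N))%E.
    have := dominated_ge i t0 t1 tc ok0; rewrite count_s0 size_s0 -/delta.
    have mX : measurable [set tau | pat m tau = s0 /\ dominated (pat (m + i) tau)].
      by apply: measurableI; [exact: measurable_pattern|exact: measurable_dominated].
    rewrite -lee_fin fineK ?fin_num_measure// => /le_trans; apply.
    by apply: le_measure; rewrite ?inE// => tau [].
  apply: (le_trans le); apply: le_measure; rewrite ?inE// => tau.
  by have := @dominated_pattern_le i m tau; rewrite (addnC i).
(* The bound [delta] is uniform in [i], so it survives in the decreasing limit. *)
have cv := nonincreasing_cvg_mu (mu := Q) _ mF mFI Fdec.
apply: (@lt_le_trans _ _ delta%:E); first by rewrite lte_fin.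
rewrite (_ : [set _ | _] = \bigcap_i F i); last first.
  by apply/seteqP; split=> tau h i; [move=> _|]; apply: h.
have {}cv := cv (le_lt_trans (probability_le1 Q (mF 0%N)) (ltry 1)).
rewrite -(cvg_lim _ cv)//; apply: lime_ge; first by apply/cvg_ex; eexists; exact: cv.
by apply: nearW => i; exact: Fge.
Qed.

End Survival.

(** * The tiled configuration *)

(** Rounding [i] up to whole periods, each containing [r] occupied slots, costs at most one
    period. *)
Lemma periodic_density (b : nat -> bool) (M r : nat) : (0 < M)%N ->
  (forall j, b (j + M)%N = b j) -> (\sum_(j < M) b j)%N = r ->
  forall i, (M * \sum_(j < i) b j <= r * i + r * M)%N.
Proof.
move=> M0 per sumr i.
have sumM a : (\sum_(j < a * M) b j)%N = (a * r)%N.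
  elim: a => [|a IH]; first by rewrite mul0n big_ord0.
  rewrite mulSnr big_split_ord /= IH mulSnr; congr addn.
  rewrite -[RHS]sumr; apply: eq_bigr => j _.
  elim: (a) => [|a' IHa]; first by rewrite mul0n.
  by rewrite mulSnr addnAC per.
have : (\sum_(j < i) b j <= \sum_(j < (i %/ M).+1 * M) b j)%N.
  have iM : (i <= (i %/ M).+1 * M)%N by rewrite ltnW// ltn_ceil.
  by rewrite -(subnKC iM) big_split_ord /= leq_addr.
rewrite sumM => le; apply: (@leq_trans (M * ((i %/ M).+1 * r))%N).
  by rewrite leq_mul2l le orbT.
have := leq_divM i M; move: (i %/ M)%N => q; rewrite -mulnDr; nia.
Qed.

Section TiledConfiguration.
Variables (o : int) (n : nat) (eta : int -> nat) (M r : nat).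

Definition occupied (j : int) : bool := (j %% M%:Z)%Z < r%:Z.

Definition tiled (x : int) : nat :=
  (occupied ((x - o) %/ n%:Z)%Z * eta (o + ((x - o) %% n%:Z)%Z))%N.

(** Going left from the reference edge, the slots are [-1], [-2], and so on. *)
Definition side_occupied (d : bool) (i : nat) : bool :=
  occupied (if d then i%:Z else - 1 - i%:Z).

Section Density.
Hypotheses (M0 : (0 < M)%N) (rM : (r <= M)%N).

Lemma sum_side_occupied d : (\sum_(j < M) side_occupied d j)%N = r.
Proof.
have gen k : (\sum_(j < r + k) ((j : nat) < r)%N)%N = r.
  rewrite big_split_ord /= [X in (_ + X)%N]big1 => [|j _]; last first.
    by rewrite ltnNge leq_addr.
  by rewrite addn0 (eq_bigr (fun=> 1%N)) ?sum1_card ?card_ord// => j _; rewrite ltn_ord.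
have base : (\sum_(j < M) ((j : nat) < r)%N)%N = r.
  by have := gen (M - r)%N; rewrite subnKC.
rewrite -[RHS]base; case: d.
  apply: eq_bigr => j _; rewrite /side_occupied /occupied modz_nat modn_small//.
rewrite (reindex_inj rev_ord_inj) /=; apply: eq_bigr => j _.
rewrite /side_occupied /occupied /=.
rewrite (_ : - 1 - (M - j.+1)%N%:Z = (- 1) * M%:Z + j%:Z); last by have := ltn_ord j; lia.
by rewrite modzMDl modz_nat modn_small.
Qed.

Lemma side_occupied_density d i :
  (M * \sum_(j < i) side_occupied d j <= r * i + r * M)%N.
Proof.
apply: periodic_density => // [j|]; last exact: sum_side_occupied.
rewrite /side_occupied /occupied; case: d.
  by rewrite PoszD addrC -{1}[M%:Z]mul1r modzMDl.
rewrite (_ : - 1 - (j + M)%N%:Z = (- 1) * M%:Z + (- 1 - j%:Z)); last by lia.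
by rewrite modzMDl.
Qed.

End Density.

Hypothesis n0 : (0 < n)%N.

Lemma tiled_site d y :
  tiled (site o d y) = (side_occupied d (y %/ n) * target o d n eta y)%N.
Proof.
have n0' : n%:Z != 0 by lia.
rewrite /tiled /target /side_occupied /box_site /box_end /site.
have yn : (y %% n < n)%N by rewrite ltn_pmod.
case: d.
  have -> : o + y%:Z - o = y%:Z by lia.
  by rewrite divz_nat modz_nat.
have -> : o - 1 - y%:Z - o = (- 1 - (y %/ n)%:Z) * n%:Z + (n%:Z - 1 - (y %% n)%:Z).
  by rewrite {1}(divn_eq y n); lia.
rewrite divzMDl// divz_small ?addr0; last by lia.
rewrite modzMDl modz_small; last by lia.
by congr (_ * eta _)%N; lia.
Qed.

Lemma tiled_periodic x : tiled (x + (M * n)%:Z) = tiled x.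
Proof.
have n0' : n%:Z != 0 by lia.
rewrite /tiled (_ : x + (M * n)%:Z - o = M%:Z * n%:Z + (x - o)); last by lia.
rewrite divzMDl// modzMDl; congr (_ * _)%N.
by rewrite /occupied -{1}[M%:Z]mul1r modzMDl.
Qed.

End TiledConfiguration.

Section SlotSums.
Variables (o : int) (d : bool) (n : nat) (eta : int -> nat).
Hypothesis n0 : (0 < n)%N.

Let E (z : nat) : nat := (\sum_(z' < z) target o d n eta z')%N.

Lemma slot_sumE s i z : (z <= n)%N ->
  slot_sum o d n eta s (i * n + z) = ((\sum_(j < i) s j) * E n + s i * E z)%N.
Proof.
have step k z' : (z' <= n)%N -> slot_sum o d n eta s (k * n + z') =
    (slot_sum o d n eta s (k * n) + s k * E z')%N.
  elim: z' => [|z' IH] zn; first by rewrite /E big_ord0 muln0 !addn0.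
  rewrite addnS /slot_sum big_ord_recr /= -/(slot_sum _ _ _ _ _ _) IH ?(ltnW zn)//.
  rewrite divnMDl// divn_small// addn0 -addnA -mulnDr.
  by rewrite /E [in RHS]big_ord_recr /= {2}/target modnMDl.
move=> zn; rewrite step//; congr addn; elim: i => [|i IH].
  by rewrite /slot_sum !big_ord0.
by rewrite mulSnr step// IH big_ord_recr /= mulnDl.
Qed.

(** Within a slot filled by [s] but not by [s'], the count at the end of the slot shows that [s'] is
    already a whole copy ahead, which covers the partial one. *)
Lemma slot_sum_le (s s' : nat -> bool) : (forall i, (\sum_(j < i) s j <= \sum_(j < i) s' j)%N) ->
  forall y, (slot_sum o d n eta s y <= slot_sum o d n eta s' y)%N.
Proof.
move=> le y; rewrite (divn_eq y n) !slot_sumE ?(ltnW (ltn_pmod _ _))//.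
set i := (y %/ n)%N; set z := (y %% n)%N.
have Ez : (E z <= E n)%N.
  rewrite /E -(subnKC (ltnW (ltn_pmod y n0))) big_split_ord /= leq_addr//.
have := le i; have := le i.+1; rewrite !big_ord_recr /=.
move: (\sum_(j < i) s j)%N (\sum_(j < i) s' j)%N => S S'.
by case: (s i); case: (s' i) => /=; nia.
Qed.

End SlotSums.

(** * Fixation of the tiled configuration with positive probability *)

Section SideEvents.
Context {R : realType} (lambda : R) (p : int -> int -> R).
Variable Q : probability arrays R.

Hypothesis p_ti : translation_invariant p.

Lemma p_back d x y : p x (back d x) = p y (back d y).
Proof. by apply: p_ti; rewrite /back; case: d; lia. Qed.

Lemma p_fwd d x y : p x (fwd d x) = p y (fwd d y).
Proof. by rewrite -!backN; exact: p_back. Qed.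

Hypotheses (jump_p : jump_distribution p) (p_nn : nearest_neighbour p).

(** The unit mass of [p x] sits on the two neighbours of [x]. *)
Lemma exists_direction x : exists d, p x (back d x) != 0.
Proof.
have [pr|pr] := eqVneq (p x (back true x)) 0; last by exists true.
have [pl|pl] := eqVneq (p x (back false x)) 0; last by exists false.
case: jump_p => _ /(_ x); rewrite esum1.
  by move=> /eqP; rewrite eq_sym onee_eq0.
move=> y _; have [->|y1] := eqVneq y (x - 1); first by rewrite pr.
have [->|y2] := eqVneq y (x + 1); first by rewrite pl.
by rewrite p_nn//; lia.
Qed.

Hypotheses (lambda0 : 0 < lambda) (lawQ : array_law lambda p Q).

Lemma jump_prob_gt0 x y : p x y != 0 ->
  0 < instruction_prob lambda p x (Jump y) <= 1.
Proof.
move=> pxy; case: jump_p => /(_ x y)/andP[p0 p1] _ /=.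
have l1 : 0 < 1 + lambda by rewrite addr_gt0.
apply/andP; split; first by rewrite divr_gt0// lt_def pxy.
by rewrite ler_pdivrMr// mul1r (le_trans p1)// lerDl ltW.
Qed.

Lemma sure_often_back o d : p 0 (back d 0) != 0 -> forall y,
  sure Q [set tau : arrays | forall N, exists m, (N <= nback tau o d y m)%N].
Proof.
move=> pd y; apply: (sure_often lawQ); apply: jump_prob_gt0.
by rewrite (p_back _ _ 0).
Qed.

Lemma sure_often_fwd o d : p 0 (fwd d 0) != 0 -> forall y,
  sure Q [set tau : arrays | forall N, exists m, (N <= nfwd tau o d y m)%N].
Proof.
move=> pd y; apply: (sure_often lawQ); apply: jump_prob_gt0.
by rewrite (p_fwd _ _ 0).
Qed.

Variables (o : int) (n : nat) (eta : int -> nat).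
Hypothesis n0 : (0 < n)%N.

Lemma window_ext d i m m' tau : (forall z, (z < n)%N -> m z = m' z) ->
  window o d n i m tau = window o d n i m' tau.
Proof.
move=> mm; apply/funext => x; apply/funext => j; rewrite /window /relabel /=.
case: ifPn => // xb; rewrite mm// /site_index /box_end.
by move: xb; rewrite /in_box; case: d; lia.
Qed.

Lemma net_flow_ext d b g g' y :
  (forall z, (z < y)%N -> g (z %/ n)%N = g' (z %/ n)%N) ->
  net_flow o d n eta b g y = net_flow o d n eta b g' y.
Proof.
move=> gg; rewrite /net_flow /slot_sum; congr (_ - _)%N.
by apply: eq_bigr => z _; rewrite gg.
Qed.

(** The finite patterns are the prefixes of one sequence [g], and a single flow [U] for [g] serves
    all the slots. *)
Lemma pattern_solution d b tau :
  (forall y N, exists m, (N <= nback tau o d y m)%N) ->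
  (forall i, dominated b (pattern o d n eta b i tau)) ->
  exists u, side_solution o d tau (fun y => b (y %/ n)%N * target o d n eta y)%N u.
Proof.
move=> often dom.
pose g i := `[< good_slot o d n eta b (pattern o d n eta b i tau) i tau >].
have patE i : pattern o d n eta b i tau = mkseq g i.
  by elim: i => [//|i IH]; rewrite mkseqS -IH.
have [U flU] := flow_exists (net_flow o d n eta b g) often.
have conf i : exists w, g i ->
    confined_by o n eta (window o d n i (fun z => U (i * n + z)%N) tau) w.
  have [/asboolP gi|//] := boolP (g i); last by exists [::].
  have gi' : g i by exact/asboolP.
  move: gi; rewrite patE => -[U' _ [[sU' flU'] [w cw]]]; exists w => _.
  (* As slot [i] is good, the tested pattern ending in [true] is a prefix of [g]; by uniqueness the
     tested flow is the restriction of [U]. *)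
  rewrite (@window_ext _ _ _ (fun z => nth 0%N U' (i * n + z)))// => z zn.
  apply: (flow_unique _ (flU (i.+1 * n)%N) flU'); last first.
    by rewrite mulSnr ltn_add2l.
  move=> y yi; apply: net_flow_ext => z' z'y.
  have z'i : (z' %/ n < i.+1)%N by rewrite ltn_divLR// (ltn_trans z'y).
  rewrite nth_rcons size_mkseq; case: ltngtP => [lt|gt|->].
  - by rewrite nth_mkseq.
  - by move: z'i gt; lia.
  - by [].
have [w cw] := choice conf.
have domS : forall y, (slot_sum o d n eta b y <= slot_sum o d n eta g y)%N.
  apply: slot_sum_le => // i; have := dom i i; rewrite patE size_mkseq leqnn => /(_ isT).
  rewrite take_oversize ?size_mkseq// => le; apply: (leq_trans le).
  rewrite /mkseq count_map -sum1_count.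
  rewrite -(big_mkord xpredT (fun j => nat_of_bool (g j))) /index_iota subn0.
  by rewrite big_mkcond /=; apply: eq_leq; apply: eq_bigr => j _; case: (g j).
by eexists; exact: (good_side_solution n0 flU domS cw).
Qed.

Variables (M r : nat).
Hypothesis rM : r%:R < fine (Q (confined o n eta)) * M%:R.

(** The event is split in two: [A] is read on one side only, as independence of the sides requires,
    and [E] is almost sure. *)
Lemma side_event d (b : nat -> bool) :
  (forall i, (M * \sum_(j < i) b j <= r * i + r * M)%N) ->
  exists A E : set arrays, [/\ measurable A, (0 < Q A)%E,
    supported (fun k => on_side o d k.1) A, sure Q E &
    forall tau, A tau -> E tau -> exists u,
      side_solution o d tau (fun y => b (y %/ n)%N * target o d n eta y)%N u].
Proof.
move=> dens; have [back0|back1] := eqVneq (p 0 (back d 0)) 0; last first.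
  have often := sure_often_back o back1.
  exists [set tau | forall i, dominated b (pattern o d n eta b i tau)].
  exists (\bigcap_y [set tau : arrays | forall N, exists m, (N <= nback tau o d y m)%N]).
  split.
  - rewrite (_ : [set _ | _] =
        \bigcap_i [set tau | dominated b (pattern o d n eta b i tau)]).
      by apply: bigcapT_measurable => i; exact: measurable_dominated.
    by apply/seteqP; split=> tau h i; [move=> _|]; exact: h.
  - exact: (survival lawQ p_ti n0 often rM dens).
  - move=> tau tau' e h i.
    have := @pattern_supported o d n eta b n0 i (pattern o d n eta b i tau) tau tau'.
    move=> /(_ _ erefl) /= patE; rewrite patE; first exact: h.
    by move=> k /andP[ks _]; exact: e.
  - exact: sure_bigcap.
  - by move=> tau dom often'; apply: pattern_solution => // y; exact: often'.
(* Back jumps have probability zero here, so forward jumps do not, and almost surely all the mass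
   can be pushed outwards. *)
have [d' pd'] := exists_direction 0.
have fwd1 : p 0 (fwd d 0) != 0.
  rewrite -backN; suff <- : d' = ~~ d by [].
  by case: d' d back0 pd' => -[] // -> ; rewrite eqxx.
exists setT, (\bigcap_(y : nat) \bigcap_(i : nat)
    [set tau : arrays | tau (site o d y) i <> Jump (back d (site o d y))] `&`
  \bigcap_(y : nat) [set tau : arrays | forall N, exists m, (N <= nfwd tau o d y m)%N]).
split=> //.
- by rewrite probability_setT lte01.
- apply: sureI; apply: sure_bigcap => y; last exact: sure_often_fwd.
  apply: sure_bigcap => i; apply: (sure_neq lawQ).
  by rewrite /= (p_back _ _ 0) back0 mul0r.
- move=> tau _ [h1 h2]; apply: escape_side_solution => [y i|y].
    exact: (h1 y Logic.I i Logic.I).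
  exact: (h2 y Logic.I).
Qed.

(** The two sides read disjoint sets of instructions, so their events occur together with positive
    probability, and their odometers are glued. *)
Lemma tiled_fixates : (0 < M)%N -> (r <= M)%N ->
  exists2 A : set arrays, measurable A /\ (0 < Q A)%E &
    forall tau, A tau -> fixates tau R (all_active (tiled o n eta M r)).
Proof.
move=> M0 rM'.
have dens := side_occupied_density M0 rM'.
have [A1 [E1 [mA1 A1p sA1 sE1 sol1]]] := side_event true (dens true).
have [A2 [E2 [mA2 A2p sA2 sE2 sol2]]] := side_event false (dens false).
have sE := sureI (sureI sE1 sE2) (sure_nearest lawQ p_nn).
exists ((A1 `&` A2) `&` (E1 `&` E2 `&` [set tau : arrays | nearest_jumps tau])).
  split; first by apply: measurableI; [exact: measurableI|case: sE].
  rewrite (sure_setI sE); last exact: measurableI.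
  rewrite (indep_supported lawQ mA1 mA2 sA1).
    by rewrite mule_gt0.
  by apply: supported_sub sA2 => k; rewrite /on_side /= -ltNge.
move=> tau [[A1t A2t] [[E1t E2t] nn]].
have [u1 s1] := sol1 tau A1t E1t; have [u2 s2] := sol2 tau A2t E2t.
apply: (@side_solutions_fixate R tau o _ (fun d => if d then u1 else u2)) => // d.
rewrite (_ : (fun y => _) = (fun y => side_occupied M r d (y %/ n) * target o d n eta y)%N).
  by case: d.
by apply/funext => y; rewrite tiled_site.
Qed.

End SideEvents.

(** * The event that no particle leaves the box *)

Section EscapeEvent.
Variables (V : set int) (c : int -> nat).

Lemma topplings_ext (tau tau' : arrays) alpha :
  (forall x i, x \in alpha -> (i < size alpha)%N -> tau x i = tau' x i) ->
  after tau (all_active c) alpha = after tau' (all_active c) alpha /\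
  (legal tau (all_active c) alpha -> legal tau' (all_active c) alpha).
Proof.
elim/last_ind: alpha => [//|alpha x IH] e.
have [|aE leg] := IH.
  move=> y i ya ia; apply: e; first by rewrite mem_rcons inE ya orbT.
  by rewrite size_rcons (ltn_trans ia).
split.
  rewrite !after_rcons aE (e x)//; first by rewrite mem_rcons mem_head.
  by rewrite size_rcons ltnS count_size.
by move=> /legal_rcons[/leg l act]; apply/legal_rcons; rewrite -aE.
Qed.

(** A given sequence of topplings reads finitely many instructions. *)
Lemma measurable_stabilizing alpha (P : configuration -> Prop) :
  measurable [set tau : arrays | stabilizing tau V (all_active c) alpha /\
                                 P (after tau (all_active c) alpha)].
Proof.
apply: (@measurable_supported_seq [seq (x, i) | x <- alpha, i <- iota 0 (size alpha)]).
move=> tau tau' e [[sub leg st] Pa].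
have [|aE leg'] := @topplings_ext tau tau' alpha.
  by move=> x i xa ia; apply: (e (x, i)); apply: allpairs_f => //; rewrite mem_iota.
by rewrite /stabilizing /= -aE; split=> //; split=> //; exact: leg'.
Qed.

Let stab := [set tau : arrays | exists alpha, stabilizing tau V (all_active c) alpha].

Lemma measurable_stab : measurable stab.
Proof.
rewrite (_ : stab = \bigcup_alpha [set tau : arrays |
    stabilizing tau V (all_active c) alpha /\ setT (after tau (all_active c) alpha)]).
  by apply: countable_bigcupT_measurable => // alpha; exact: (measurable_stabilizing _ setT).
by apply/seteqP; split=> tau [alpha]; [exists alpha|move=> _ []; exists alpha].
Qed.

Lemma measurable_escaped_eq0 : finite_set V -> (forall x, ~ V x -> c x = 0%N) ->
  measurable [set tau : arrays | escaped tau V c = 0%N].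
Proof.
move=> finV c0; pose noexit (xi : configuration) := forall x, ~ V x -> particles (xi x) = 0%N.
rewrite (_ : [set _ | _] = (\bigcup_alpha [set tau : arrays |
    stabilizing tau V (all_active c) alpha /\ noexit (after tau (all_active c) alpha)])
    `|` ~` stab).
  apply: measurableU; last by apply: measurableC; exact: measurable_stab.
  by apply: countable_bigcupT_measurable => // alpha; exact: measurable_stabilizing.
apply/seteqP; split=> tau /=.
  move=> /(escaped_eq0 tau c0 finV)[[alpha sa out]|no]; last by right.
  by left; exists alpha.
move=> h; apply/(escaped_eq0 tau c0 finV); case: h => [[alpha _ [sa out]]|no]; last by right.
by left; exists alpha.
Qed.

End EscapeEvent.

Section BoxStabilizes.
Context {R : realType} (lambda : R) (p : int -> int -> R).
Variable Q : probability arrays R.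
Hypotheses (lambda0 : 0 < lambda) (jump_p : jump_distribution p).
Hypotheses (p_nn : nearest_neighbour p) (p_ti : translation_invariant p).
Hypothesis lawQ : array_law lambda p Q.
Variables (n : nat) (eta : int -> nat).
Hypotheses (n0 : (0 < n)%N) (eta0 : forall x, ~ box n x -> eta x = 0%N).

Let box_in : box n = [set x | in_box (box_left n) n x].
Proof. exact: boxE. Qed.

Lemma finite_box : finite_set (box n).
Proof.
apply: (@sub_finite_set _ _ [set` [seq site (box_left n) true y | y <- iota 0 n]]).
  rewrite box_in => x /andP[x1 x2]; apply/mapP.
  exists (site_index (box_left n) true x); last by rewrite site_indexK //.
  by rewrite mem_iota /site_index; lia.
exact: finite_seq.
Qed.

(** The reference edge is put at the end of the box towards which jumps have positive probability;
    everything can be sent out there. *)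
Lemma sure_box_stabilizes : sure Q [set tau : arrays |
  exists alpha, stabilizing tau (box n) (all_active eta) alpha].
Proof.
have [d pd] := exists_direction jump_p p_nn 0.
pose o := box_end (box_left n) d n.
have often := sure_often_back p_ti jump_p lambda0 lawQ o pd.
apply: (sure_sub (sureI (sure_nearest lawQ p_nn) (sure_bigcap often))).
  exact: measurable_stab.
move=> tau [nn often_tau].
have [alpha] := @box_stabilizes tau eta o d n nn (fun y => often_tau y Logic.I).
rewrite (_ : [set x | _] = box n); first by move=> sa; exists alpha.
rewrite box_in; apply/seteqP.
by split=> x /=; rewrite /in_box /on_side /site_index /o /box_end; case: (d); lia.
Qed.

Lemma escaped_le_confined :
  (Q [set tau : arrays | escaped tau (box n) eta = 0%N] <=
   Q (confined (box_left n) n eta))%E.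
Proof.
apply: (sure_le sure_box_stabilizes).
- exact: measurable_escaped_eq0 finite_box eta0.
- exact: measurable_confined.
move=> tau [/(escaped_eq0 tau eta0 finite_box)[|no]]; last by move=> /no.
move=> [alpha sa out] _.
have out' x : ~~ in_box (box_left n) n x -> ~ box n x.
  by rewrite box_in /= => /negP.
apply: (@stabilizing_confined _ _ _ tau alpha) => //.
- by move=> x /out'; exact: eta0.
- by rewrite -box_in.
- by move=> x /out'; exact: out.
Qed.

End BoxStabilizes.

(** * Periodic configurations and their uniform shifts *)

Lemma big_periodic (T : Type) (idx : T) (op : Monoid.com_law idx) (L : nat)
    (h : int -> T) (z : int) : (forall k, h (k + L%:Z) = h k) ->
  \big[op/idx]_(j < L) h (z + j%:Z) = \big[op/idx]_(j < L) h j%:Z.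
Proof.
move=> hper.
(* Moving the start by one replaces the first term by an equal one, a period later, at the end. *)
have step k : \big[op/idx]_(j < L) h (k + 1 + j%:Z) = \big[op/idx]_(j < L) h (k + j%:Z).
  case: L hper => [|L'] hper'; first by rewrite !big_ord0.
  rewrite big_ord_recr [RHS]big_ord_recl /= Monoid.mulmC; congr (op _ _).
    by rewrite (_ : k + 1 + L'%:Z = k + 0%N%:Z + L'.+1%:Z) ?hper'//; lia.
  by apply: eq_bigr => j _; congr h; rewrite /bump /=; lia.
elim/int_rect: z => [|m IH|m IH].
- by apply: eq_bigr => j _; rewrite add0r.
- by rewrite -[RHS]IH -[RHS]step; apply: eq_bigr => j _; congr h; lia.
- by rewrite -[RHS]IH -[LHS]step; apply: eq_bigr => j _; congr h; lia.
Qed.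

Section PeriodicLaw.
Context {R : realType}.
Variables (c : configs) (L : nat).
Hypotheses (L0 : (0 < L)%N) (per : forall x, c (x + L%:Z) = c x).

Definition shifts_sum : {measure set configs -> \bar R} :=
  msum (fun j : nat => \d_(translate j%:Z c)) L.

(** The uniform law on the shifts of [c] by [0], ..., [L - 1], counted with multiplicity. *)
Definition shift_law : probability configs R :=
  mnormalize shifts_sum (\d_c).

Lemma shifts_sumE A :
  shifts_sum A = (\sum_(j < L) (translate j%:Z c \in A)%:R%:E)%E.
Proof. by rewrite /shifts_sum /= /msum; apply: eq_bigr => j _; rewrite /= diracE. Qed.

Lemma shift_lawE A : shift_law A = (shifts_sum A * (L%:R^-1)%:E)%E.
Proof.
have eT : shifts_sum setT = L%:R%:E.
  rewrite shifts_sumE (eq_bigr (fun=> 1%:E)); last by move=> j _; rewrite in_setT.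
  by rewrite sumEFin sumr_const card_ord.
rewrite /shift_law /= /mnormalize eT /= eqe pnatr_eq0.
by rewrite eqn0Ngt L0.
Qed.

Lemma translateD y z (eta : configs) :
  translate y (translate z eta) = translate (y + z) eta.
Proof. by apply/funext => x; rewrite /translate addrA. Qed.

Lemma translate_period z : translate (z + L%:Z) c = translate z c.
Proof. by apply/funext => x; rewrite /translate addrA per. Qed.

Lemma translate_mem z j (A : set configs) :
  (translate j c \in translate z @^-1` A) = (translate (z + j) c \in A).
Proof. by rewrite -translateD; apply/idP/idP; rewrite !inE. Qed.

(** An invariant event contains all the shifts of [c] or none of them. *)
Lemma shift_law_ergodic : translation_ergodic shift_law.
Proof.
split=> [z A mA|A mA inv].
  rewrite !shift_lawE !shifts_sumE; congr (_ * _)%E.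
  rewrite -(@big_periodic _ _ _ L (fun k => (translate k c \in A)%:R%:E) z).
    by apply: eq_bigr => j _; rewrite translate_mem.
  by move=> k; rewrite translate_period.
have inA j : (translate j c \in A) = (c \in A).
  rewrite -[X in _ \in X](inv (- j)) translate_mem addNr; congr (_ \in A).
  by apply/funext => x; rewrite /translate addr0.
rewrite !shift_lawE !shifts_sumE; under eq_bigr => j _ do rewrite inA.
case: (c \in A); [right|left].
  by rewrite sumEFin sumr_const card_ord -EFinM divff// pnatr_eq0 -lt0n.
by rewrite big1// mul0e.
Qed.

Lemma measurable_config_at x (B : set nat) :
  measurable [set eta : configs | B (eta x)].
Proof.
rewrite (_ : [set _ | _] = \bigcup_k [set eta : configs | eta x = k /\ B k]).
  apply: bigcupT_measurable => k; have [Bk|Bk] := pselect (B k).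
    rewrite (_ : [set _ | _] = [set eta : configs | eta x = k]).
      by apply: sub_sigma_algebra; exists x, k.
    by apply/seteqP; split=> [eta []|].
  by rewrite (_ : [set _ | _] = set0)// -subset0 => eta [].
by apply/seteqP; split=> [eta Be|eta [k _ [<-]]]//; exists (eta x).
Qed.

Lemma shift_law_mean :
  mean_density shift_law = ((\sum_(j < L) c j%:Z)%N%:R / L%:R)%:E.
Proof.
pose f (eta : configs) : \bar R := ((eta 0)%:R : R)%:E.
have mf : measurable_fun setT f.
  by move=> _ B mB; rewrite setTI; exact: (measurable_config_at 0 (fun k => B k%:R%:E)).
have f0 eta : (0 <= f eta)%E by rewrite lee_fin.
rewrite /mean_density -/f.
have Linv : 0 <= L%:R^-1 :> R by rewrite invr_ge0.
rewrite (@eq_measure_integral _ _ _ _ (mscale (NngNum Linv) shifts_sum)); last first.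
  by move=> A mA _; rewrite /= shift_lawE muleC.
rewrite ge0_integral_mscale// ge0_integral_measure_sum//.
rewrite (eq_bigr (fun j : 'I_L => ((c j%:Z)%:R)%:E)); last first.
  by move=> j _; rewrite integral_dirac// diracT mul1e /f /translate add0r.
by rewrite sumEFin -natr_sum -EFinM mulrC.
Qed.

Lemma measurable_config : measurable [set c].
Proof.
rewrite (_ : [set c] = ~` (\bigcup_(x : int) [set eta : configs | (~` [set c x]) (eta x)])).
  apply: measurableC; apply: countable_bigcupT_measurable => // x.
  exact: measurable_config_at.
apply/seteqP; split=> [eta -> [x _ nc]|eta h]; first exact: nc.
apply/funext => x.
by apply: contrapT => cx; apply: h; exists x.
Qed.

Lemma shift_law_config : (0 < shift_law [set c])%E.
Proof.
rewrite shift_lawE shifts_sumE mule_gt0//; last by rewrite lte_fin invr_gt0 ltr0n.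
rewrite (bigD1 (Ordinal L0))//= (_ : translate _ c = c); last first.
  by apply/funext => x; rewrite /translate addr0.
by rewrite mem_set// (@lt_le_trans _ _ 1%E) ?lte01// leeDl// sume_ge0.
Qed.

End PeriodicLaw.

(** * Comparison with the critical density *)

Lemma density_le (R : realType) (lambda : R) p zeta_c (Q : probability arrays R)
    (c : configs) (L : nat) (A : set arrays) :
  critical_density lambda p zeta_c -> array_law lambda p Q -> (0 < L)%N ->
  (forall x, c (x + L%:Z) = c x) -> measurable A -> (0 < Q A)%E ->
  (forall tau, A tau -> fixates tau R (all_active c)) ->
  (\sum_(j < L) c j%:Z)%N%:R / L%:R <= zeta_c.
Proof.
move=> crit lawQ L0 per mA QA fix_A; rewrite leNgt; apply/negP => lt.
have [_ /(_ lt)] := crit Q _ _ lawQ (shift_law_ergodic L0 per) (shift_law_mean c L0).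
move=> [N [mN N0 subN]].
have mc := @measurable_config c.
(* Above the critical density, fixation is null under the product law; yet it holds on the product
   of the atom [[set c]] and [A], which has positive measure. *)
suff : (0 < (shift_law c L \x Q)%E ([set c] `*` A))%E.
  rewrite (@subset_measure0 _ _ _ _ _ N) ?ltxx//; first exact: measurableX.
  by move=> [eta tau] [/= -> At]; apply: subN => /=; apply; exact: fix_A.
by rewrite product_measure1E// mule_gt0// shift_law_config.
Qed.

Lemma empty_fixates (R : realType) tau : fixates tau R (all_active (fun=> 0%N)).
Proof.
have sup x : setT x -> supersolution tau (fun=> 0%N) (fun=> 0%N) x.
  by move=> _ F _; rewrite /incoming big1.
rewrite /fixates (@le_lt_trans _ _ (0%N%:R%:E)) ?ltry//.
apply: ge_ereal_sup => _ [alpha leg <-]; rewrite lee_fin ler_nat.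
exact: (least_action sup leg (fun _ _ => Logic.I)).
Qed.

(** The empty configuration has density zero and fixates. *)
Lemma critical_density_ge0 (R : realType) (lambda : R) p zeta_c (Q : probability arrays R) :
  critical_density lambda p zeta_c -> array_law lambda p Q -> 0 <= zeta_c.
Proof.
move=> crit lawQ.
have := @density_le R lambda p zeta_c Q (fun=> 0%N) 1 setT crit lawQ isT (fun=> erefl).
rewrite big_ord1 mul0r; apply => //; first by rewrite probability_setT lte01.
by move=> tau _; exact: empty_fixates.
Qed.

Lemma sum_tiled o n eta M r : (0 < n)%N -> (0 < M)%N -> (r <= M)%N ->
  (\sum_(j < M * n) tiled o n eta M r j%:Z = r * \sum_(z < n) eta (o + z%:Z)%R)%N.
Proof.
move=> n0 M0 rM.
have -> : (\sum_(j < M * n) tiled o n eta M r j%:Z =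
           \sum_(j < M * n) tiled o n eta M r (o + j%:Z)%R)%N.
  rewrite (@big_periodic _ _ _ _ (tiled o n eta M r))// => x.
  exact: tiled_periodic.
rewrite (eq_bigr (fun j : 'I_(M * n) =>
    side_occupied M r true (j %/ n) * target o true n eta j)%N); last first.
  by move=> j _; rewrite -tiled_site.
rewrite -/(slot_sum o true n eta (side_occupied M r true) (M * n)) -[(M * n)%N]addn0.
rewrite slot_sumE// sum_side_occupied// big_ord0 muln0 addn0; congr muln.
by apply: eq_bigr => z _; rewrite /target modn_small.
Qed.

Lemma rational_between (R : realType) (a q : R) : 0 <= a -> a < q ->
  exists M r : nat, [/\ (0 < M)%N, a * M%:R < r%:R & r%:R < q * M%:R].
Proof.
move=> a0 aq; have qa : 0 < q - a by rewrite subr_gt0.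
(* With [M] above the inverse of [q - a], the interval from [a * M] to [q * M] is longer than one
   and contains the first integer beyond [a * M]. *)
pose M := (Num.truncn (q - a)^-1).+1; exists M, (Num.truncn (a * M%:R)).+1.
have /andP[_ hM] : (Num.truncn (q - a)^-1)%:R <= (q - a)^-1 < M%:R.
  by apply: truncn_itv; rewrite invr_ge0 ltW.
have /andP[h1 h2] : (Num.truncn (a * M%:R))%:R <= a * M%:R < (Num.truncn (a * M%:R)).+1%:R.
  by apply: truncn_itv; rewrite mulr_ge0.
split=> //; rewrite -natr1.
have : 1 < (q - a) * M%:R by rewrite -ltr_pdivrMl// mulr1.
by rewrite mulrBl; lra.
Qed.

Theorem theorem5 (R : realType) (lambda : R) (p : int -> int -> R) (zeta_c : R)
    (Q : probability arrays R) :
  0 < lambda ->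
  jump_distribution p ->
  nearest_neighbour p ->
  translation_invariant p ->
  critical_density lambda p zeta_c ->
  array_law lambda p Q ->
  forall (zeta : R) (n : nat) (eta : int -> nat),
    zeta_c < zeta ->
    (1 <= n)%N ->
    (forall x, ~ box n x -> eta x = 0%N) ->
    zeta * n%:R <= (\big[addn/0%N]_(x \in box n) eta x)%:R ->
    (Q [set tau : arrays | escaped tau (box n) eta = 0%N]
       <= (zeta_c / zeta)%:E)%E.
Proof.
move=> lambda0 jump_p p_nn p_ti crit lawQ zeta n eta zeta_gt n0 eta0 mass.
have zc0 := critical_density_ge0 crit lawQ.
have zeta0 : 0 < zeta by exact: le_lt_trans zc0 zeta_gt.
apply: le_trans (escaped_le_confined lambda0 jump_p p_nn p_ti lawQ n0 eta0) _.
set o := box_left n.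
have mconf := measurable_confined o n eta.
have qfin : Q (confined o n eta) \is a fin_num by exact: fin_num_measure.
rewrite -(fineK qfin) lee_fin leNgt; set q := fine _; apply/negP => qgt.
have q1 : q <= 1 by rewrite -lee_fin fineK// probability_le1.
move: mass; rewrite sum_box//; set k := (\sum_(z < n) _)%N => mass.
have nR : 0 < n%:R :> R by rewrite ltr0n.
have kR : 0 < k%:R :> R by apply: lt_le_trans mass; exact: mulr_gt0.
(* As [k] is at least [zeta * n], this ratio is at most [zeta_c / zeta], which is below [q] by
   contradiction hypothesis. *)
have aq : zeta_c * n%:R / k%:R < q.
  apply: le_lt_trans qgt; rewrite ler_pdivrMr// mulrAC ler_pdivlMr// -mulrA.
  by rewrite ler_wpM2l// mulrC.
have a0 : 0 <= zeta_c * n%:R / k%:R by rewrite divr_ge0 ?mulr_ge0.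
have [M [r [M0 ar rq]]] := rational_between a0 aq.
have MR : 0 < M%:R :> R by rewrite ltr0n.
have rM : (r <= M)%N.
  by rewrite -(ler_nat R) (le_trans (ltW rq))// ler_piMl.
have [A [mA QA] fix_A] := tiled_fixates p_ti jump_p p_nn lambda0 lawQ n0 rq M0 rM.
have Mn0 : (0 < M * n)%N by rewrite muln_gt0 M0.
have := density_le crit lawQ Mn0 (tiled_periodic o eta M r n0) mA QA fix_A.
(* The tiled configuration fixates with positive probability, yet its density [r * k / (M * n)]
   exceeds [zeta_c] by the choice of [r] and [M]. *)
rewrite sum_tiled// -/o -/k leNgt => /negP; apply.
rewrite ltr_pdivlMr ?ltr0n// !natrM mulrA.
by move: ar; rewrite mulrAC ltr_pdivrMr// mulrAC.
Qed.
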